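(* Let $X$ be an affine complex variety and $f:X(\mathbb{C}) \to \mathbb{C}$ be a continuous function (for the Euclidean topology). Let $\Gamma_f =\{ (x,f(x)) \mid x\in X(\mathbb{C}) \} \subset X(\mathbb{C})\times \mathbb{A}^1(\mathbb{C})$ be the graph of $f$. Then the following properties are equivalent: 1) The graph $\Gamma_f$ is Zariski closed. 2) $f\in \mathcal{K}^0(X(\mathbb{C}))$.
   Context: An affine complex variety is $X=\operatorname{Spec}(\mathbb{C}[X])$ with $\mathbb{C}[X]$ a reduced finitely generated $\mathbb{C}$-algebra ($X$ need not be irreducible). $X(\mathbb{C})$ is the set of closed points of $X$, identified with a Zariski closed subset of some $\mathbb{C}^n$. A function $f:X(\mathbb{C})\to\mathbb{C}$ is rational if it is regular on some Zariski dense Zariski open subset of $X(\mathbb{C})$. $\mathcal{K}^0(X(\mathbb{C}))$ is the ring of functions $f:X(\mathbb{C})\to\mathbb{C}$ that are rational and continuous on all of $X(\mathbb{C})$ for the Euclidean topology. *)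

(* Defs.v *)
From HB Require Import structures.
From mathcomp Require Import all_boot all_order all_algebra.
From mathcomp Require Import complex.
(* mpoly is not imported: its notations clash with those of mathcomp-analysis. *)
From mathcomp Require mpoly.
From mathcomp Require Import all_classical all_reals all_analysis.

Set Implicit Arguments.
Unset Strict Implicit.
Unset Printing Implicit Defensive.

Import Order.TTheory GRing.Theory Num.Theory.
Import numFieldNormedType.Exports.

Local Open Scope classical_set_scope.
Local Open Scope ring_scope.

(* Typing R[i] as a numClosedFieldType makes C and 'rV[C]_n inherit the
   topology of the modulus, that is, the Euclidean topology. *)
Definition Cplx (R : realType) : numClosedFieldType := R[i].

(* Points of C^n are row vectors. *)
Definition peval (R : realType) (n : nat) (p : mpoly.mpoly n (Cplx R))
    (x : 'rV[Cplx R]_n) : Cplx R :=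
  mpoly.meval (fun i => x ord0 i) p.

Definition zariski_closed (R : realType) (n : nat)
    (A : set 'rV[Cplx R]_n) : Prop :=
  exists S : set (mpoly.mpoly n (Cplx R)),
    A = [set x | forall p, S p -> peval p x = 0].

Definition zariski_closed_in (R : realType) (n : nat)
    (X A : set 'rV[Cplx R]_n) : Prop :=
  exists2 Z, zariski_closed Z & A = X `&` Z.

Definition zariski_open_in (R : realType) (n : nat)
    (X U : set 'rV[Cplx R]_n) : Prop :=
  exists2 Z, zariski_closed Z & U = X `\` Z.

Definition zariski_dense_in (R : realType) (n : nat)
    (X U : set 'rV[Cplx R]_n) : Prop :=
  U `<=` X /\
  forall V, zariski_open_in X V -> V !=set0 -> (V `&` U) !=set0.

(* A function X(C) -> C is represented by a total function on C^n of which only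
   the values on X are ever used. *)

Definition regular_on (R : realType) (n : nat) (X U : set 'rV[Cplx R]_n)
    (f : 'rV[Cplx R]_n -> Cplx R) : Prop :=
  forall x, U x ->
  exists V : set 'rV[Cplx R]_n, exists p q : mpoly.mpoly n (Cplx R),
    [/\ zariski_open_in X V, V x, V `<=` U &
        forall y, V y -> peval q y != 0 /\ f y = peval p y / peval q y].

Definition rational_on (R : realType) (n : nat) (X : set 'rV[Cplx R]_n)
    (f : 'rV[Cplx R]_n -> Cplx R) : Prop :=
  exists U, [/\ zariski_open_in X U, zariski_dense_in X U & regular_on X U f].

Definition K0 (R : realType) (n : nat) (X : set 'rV[Cplx R]_n) :
    set ('rV[Cplx R]_n -> Cplx R) :=
  [set f | rational_on X f /\ {within X, continuous f}].

(* X x A^1, with C^n x C identified with C^(n+1). *)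
Definition prod_line (R : realType) (n : nat) (X : set 'rV[Cplx R]_n) :
    set 'rV[Cplx R]_(n + 1) :=
  [set z | X (lsubmx z)].

Definition graph_on (R : realType) (n : nat) (X : set 'rV[Cplx R]_n)
    (f : 'rV[Cplx R]_n -> Cplx R) : set 'rV[Cplx R]_(n + 1) :=
  [set row_mx x (const_mx (f x)) | x in X].

(* Main.v *)
Require Import Defs.
From HB Require Import structures.
From mathcomp Require Import all_boot all_order all_algebra.
From mathcomp Require Import complex.
From mathcomp Require mpoly.
From mathcomp Require Import boolp classical_sets filter.

(** A closed graph is generically rational. Over a nonempty open subset of X,
    take a relation P(x, t) satisfied by t = f x and of least degree d in t.
    Dividing by P the equations of the graph shows that, where the leading
    coefficient a of P does not vanish, f x is the only root of P(x, t). Hence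
    P = a (t - f x) ^ d, and f is - b / (d a) where b is the next coefficient.
    Such open subsets meet every nonempty open subset of X
    ([generic_rational]).

    Conversely, let f be continuous on X and regular on a dense open U. The
    graph of f over U is Zariski open in its Zariski closure. The point is that
    for such a set V the Zariski closure is contained in the Euclidean closure
    ([euclidean_closure]). Applied to U, this shows that every polynomial
    vanishing on the graph over U vanishes on the graph over X; applied to the
    graph over U, it shows that a point (x0, t0) of the Zariski closure of the
    graph is a limit of points (x, f x), so that t0 = f x0 by continuity
    ([graph_closure]).

    To prove [euclidean_closure] at z0, an ultrafilter on V that is finer than
    all Zariski neighbourhoods of z0 provides a prime ideal, that is, a generic
    point xi in a domain, which specializes to z0 and at which some g is nonzero,
    where g defines an open piece of V ([generic_point]); the Hilbert basis
    theorem makes g available. It remains to find, near z0, specializations of xi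
    at which g is nonzero ([specialization_near]). This is the openness of the
    finite projection to affine space given by Noether normalization. It comes
    from the continuity of the roots of a minimal polynomial, which is monic
    because polynomial rings are integrally closed ([gauss]), and from lifting
    specializations along integral extensions ([lift_place]). Only points of one
    line in the affine space below are needed, so all estimates concern
    polynomials in one parameter. *)

Import Order.TTheory GRing.Theory Num.Theory.

Local Open Scope classical_set_scope.
Local Open Scope ring_scope.

Module AffineGeometry.

Import mpoly Pdiv.CommonRing Pdiv.RingMonic.

Set Implicit Arguments.
Unset Strict Implicit.
Unset Printing Implicit Defensive.

(** * Polynomials restricted to lines *)

Lemma mmap_ext (n : nat) (R S : nzRingType) (f f' : R -> S) (h h' : 'I_n -> S)
    (p : {mpoly R[n]}) :
  f =1 f' -> h =1 h' -> mmap f h p = mmap f' h' p.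
Proof.
move=> ff hh; rewrite /mmap; apply: eq_bigr => m _.
by rewrite ff (mmap1_eq _ hh).
Qed.

Lemma rmorph_mmap (n : nat) (R S T : comNzRingType) (f : R -> S)
    (h : 'I_n -> S) (phi : {rmorphism S -> T}) (p : {mpoly R[n]}) :
  phi (mmap f h p) = mmap (phi \o f) (phi \o h) p.
Proof.
rewrite /mmap rmorph_sum; apply: eq_bigr => m _.
rewrite rmorphM /mmap1 rmorph_prod; congr (_ * _).
by apply: eq_bigr => i _; rewrite rmorphXn.
Qed.

Lemma mmap_id (n : nat) (R : comNzRingType) (p : {mpoly R[n]}) :
  mmap (@mpolyC n R) (fun i => 'X_i) p = p.
Proof.
rewrite {2}[p]mpolyE /mmap; apply: eq_bigr => m _.
by rewrite mmap1_id mul_mpolyC.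
Qed.

Lemma mpoly_rmorph_eq (n : nat) (R T : comNzRingType)
    (F G : {rmorphism {mpoly R[n]} -> T}) :
    (forall c, F c%:MP = G c%:MP) -> (forall i, F 'X_i = G 'X_i) ->
  F =1 G.
Proof.
move=> eqC eqX p; rewrite -[p]mmap_id !rmorph_mmap; exact: mmap_ext.
Qed.

(** The roots being finite in number, one of the points d / (i + 2) works. *)
Lemma ex_small_nonroot (C : numFieldType) (p : {poly C}) (d : C) :
  p != 0 -> 0 < d -> exists t, `|t| < d /\ p.[t] != 0.
Proof.
move=> p0 d0; apply: contrapT => H.
pose s := [seq d / (i.+2)%:R | i <- iota 0 (size p)].
have us : uniq s.
  rewrite map_inj_uniq ?iota_uniq // => i j /(mulfI (lt0r_neq0 d0)) /invr_inj /eqP.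
  by rewrite eqr_nat => /eqP [].
have rs : all (root p) s.
  apply/allP => x /mapP [i _ ->]; apply/negPn/negP => nr; apply: H.
  exists (d / (i.+2)%:R); split => //.
  rewrite ger0_norm ?divr_ge0 ?ler0n ?(ltW d0) //.
  by rewrite ltr_pdivrMr ?ltr0n // ltr_pMr // ltr1n.
by have := max_poly_roots p0 rs us; rewrite size_map size_iota ltnn.
Qed.

Lemma muniK (n : nat) (R : comNzRingType) (p : {mpoly R[n.+1]}) :
  (map_poly (@mwiden n R) (muni p)).['X_ord_max] = p.
Proof.
pose back := horner_eval 'X_ord_max \o map_poly (@mwiden n R) \o @muni n R.
apply: (mpoly_rmorph_eq (F := back) (G := idfun)) => [c|i] /=.
  by rewrite muniC map_polyC /= mwidenC horner_evalE hornerC.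
rewrite /muni mmapX mmap1U horner_evalE; case: splitP => j /= ij.
  rewrite map_polyC hornerC /= mwidenX mnmwiden1; congr ('X_ _).
  exact: val_inj.
rewrite map_polyX hornerX; congr ('X_ _); apply: val_inj => /=.
by rewrite ij ord1 addn0.
Qed.

Lemma ex_meval_neq0 (C : numFieldType) (n : nat) (F : {mpoly C[n]}) :
  F != 0 -> exists v, F.@[v] != 0.
Proof.
elim: n F => [|n IH] F F0.
  exists (fun=> 0); apply: contraNneq F0 => FE; apply/eqP.
  have Fc : F = (F@_0)%:MP.
    by apply: msize1_polyC; rewrite msizeE; apply/bigmax_leqP_seq => m _ _;
       rewrite mdegE big_ord0.
  by move: FE; rewrite Fc mevalC => ->; rewrite mpolyC0.
have mF0 : muni F != 0.
  by apply: contraNneq F0 => e; rewrite -(muniK F) e rmorph0 horner0.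
have [v vP] : exists v, (lead_coef (muni F)).@[v] != 0.
  by apply: IH; rewrite lead_coef_eq0.
have : map_poly (meval v) (muni F) != 0.
  by rewrite -lead_coef_eq0 lead_coef_map_eq.
move=> /ex_small_nonroot /(_ ltr01) [t [_ tP]].
exists (fun i => match split (cast_ord (esym (addn1 n)) i) with
                 | inl j => v j | inr _ => t end).
apply: contraNneq tP => e; rewrite -e.
pose hm := horner_eval t \o map_poly (meval v) \o @muni n C.
apply/eqP; apply: (mpoly_rmorph_eq (F := hm) (G := meval _)) => [c|i] /=.
  by rewrite /hm /= muniC map_polyC /= /horner_eval hornerC !mevalC.
rewrite /hm /= mevalXU /muni mmapX mmap1U /horner_eval.
case: splitP => j _; first by rewrite map_polyC hornerC /= mevalXU.
by rewrite map_polyX hornerX.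
Qed.

Section Line.
Variables (C : comNzRingType) (B : comNzRingType) (iota : {rmorphism C -> B}).
Variables (n : nat) (u : 'I_n -> B) (v : 'I_n -> C).

(** The base point u may lie in any algebra over C: it is a point of affine
    space, the generic point, or a family of elements of a domain. *)
Definition line : {mpoly C[n]} -> {poly B} :=
  mmap (@polyC B \o iota) (fun i => (u i)%:P + (iota (v i))%:P * 'X).

HB.instance Definition _ := GRing.RMorphism.on line.

(** Value at v of the homogeneous component of top degree of F. *)
Definition topval (F : {mpoly C[n]}) : C :=
  \sum_(m <- msupp F | mdeg m == (msize F).-1) F@_m * mmap1 v m.

Lemma horner_line F t :
  (line F).[t] = mmap iota (fun i => u i + iota (v i) * t) F.
Proof.
rewrite -horner_evalE /line rmorph_mmap; apply: mmap_ext => x /=.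
  by rewrite horner_evalE hornerC.
by rewrite horner_evalE !hornerE.
Qed.

Let topc (p : {poly B}) k c := (size p <= k.+1)%N /\ p`_k = c.

Let topcM p q k l c d : topc p k c -> topc q l d -> topc (p * q) (k + l) (c * d).
Proof.
move=> [sp <-] [sq <-]; split.
  apply: (leq_trans (size_polyMleq _ _)).
  by rewrite -subn1 leq_subLR add1n -addnS -addSn leq_add.
have lk : (k < (k + l).+1)%N by rewrite ltnS leq_addr.
rewrite coefM (bigD1 (Ordinal lk)) //= addKn big1 ?addr0 // => j.
rewrite -val_eqE /= => jk; have [lt|] := ltnP k j.
  by rewrite nth_default ?mul0r // (leq_trans sp).
rewrite leq_eqVlt (negbTE jk) /= => jk'.
rewrite [q`_ _]nth_default ?mulr0 // (leq_trans sq) //.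
by rewrite ltn_subRL addnC addnC ltn_add2r.
Qed.

Let topc_mmap1 m :
  topc (mmap1 (fun i => (u i)%:P + (iota (v i))%:P * 'X) m) (mdeg m)
       (iota (mmap1 v m)).
Proof.
rewrite /mmap1 rmorph_prod mdegE.
elim/big_ind3: _ => [|? ? ? ? ? ?|i _]; first by split; rewrite ?size_poly1 ?coef1.
  exact: topcM.
have t1 : topc ((u i)%:P + (iota (v i))%:P * 'X) 1 (iota (v i)).
  split; last by rewrite coefD coefC coefMX coefC add0r.
  rewrite addrC -[X in (_ <= X)%N]/(size [:: 0; 1 : B]).
  apply: (leq_trans (size_polyD _ _)); rewrite geq_max.
  rewrite (leq_trans (size_polyMleq _ _)) ?size_polyX ?size_polyC /=; last by case: eqP.
  by case: eqP.
rewrite rmorphXn; elim: (m i) => [|k IHk]; first by split; rewrite ?size_poly1 ?coef1.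
by rewrite !exprS -add1n; apply: topcM.
Qed.

Lemma line_mmap1_size m k : (mdeg m < k)%N ->
  (size (mmap1 (fun i => (u i)%:P + (iota (v i))%:P * 'X)%R m) <= k)%N.
Proof. by move=> mk; apply: leq_trans mk; case: (topc_mmap1 m). Qed.

Lemma size_line F : (size (line F) <= msize F)%N.
Proof.
rewrite /line /mmap; apply: (leq_trans (size_sum _ _ _)).
apply/bigmax_leqP_seq => m mF _; rewrite /= mul_polyC.
apply: (leq_trans (size_scale_leq _ _)); apply: line_mmap1_size.
exact: msize_mdeg_lt.
Qed.

(** The coefficient does not depend on u. Along a direction where the leading
    form is nonzero, every restriction is thus monic up to one and the same
    constant; Noether normalization and the Gauss lemma both rest on this. *)
Lemma coef_line_top F : (line F)`_(msize F).-1 = iota (topval F).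
Proof.
rewrite /line /mmap coef_sum /topval rmorph_sum [RHS]big_mkcond /=.
rewrite !big_seq; apply: eq_bigr => m mF.
rewrite mul_polyC coefZ; have lt := msize_mdeg_lt mF.
case: ifPn => [/eqP <-|ne]; first by rewrite rmorphM; case: (topc_mmap1 m) => _ ->.
rewrite nth_default ?mulr0 //; apply: line_mmap1_size.
by move: lt; case: (msize F) ne => // k /= ne; rewrite ltnS leq_eqVlt (negbTE ne).
Qed.

End Line.

Lemma map_line (C B B' : comNzRingType) (iota : {rmorphism C -> B})
    (iota' : {rmorphism C -> B'}) (phi : {rmorphism B -> B'}) (n : nat)
    (u : 'I_n -> B) (v : 'I_n -> C) (F : {mpoly C[n]}) :
  (forall c, phi (iota c) = iota' c) ->
  map_poly phi (line iota u v F) = line iota' (phi \o u) v F.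
Proof.
move=> phii; rewrite /line rmorph_mmap; apply: mmap_ext => x /=.
  by rewrite map_polyC /= phii.
by rewrite rmorphD rmorphM /= map_polyX !map_polyC /= phii.
Qed.

Section LeadingForm.
Variables (C : numFieldType) (n : nat).

Definition topform (F : {mpoly C[n]}) : {mpoly C[n]} :=
  \sum_(m <- msupp F | mdeg m == (msize F).-1) F@_m *: 'X_[m].

Lemma meval_topform F v : (topform F).@[v] = topval v F.
Proof.
rewrite /topform /topval rmorph_sum; apply: eq_bigr => m _.
by rewrite /= mevalZ mevalX.
Qed.

Lemma topform_neq0 F : F != 0 -> topform F != 0.
Proof.
move=> F0; apply/negP => /eqP /(congr1 (mcoeff (mlead F))).
have dl : mdeg (mlead F) == (msize F).-1 by rewrite -(mlead_deg F0).
rewrite mcoeff0 /topform raddf_sum /= big_mkcond /=.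
rewrite (bigD1_seq (mlead F)) ?msupp_uniq ?mlead_supp //= dl.
rewrite mcoeffZ mcoeffX eqxx mulr1 big1 ?addr0 => [/eqP|m ne].
  by rewrite mleadc_eq0 (negbTE F0).
by case: ifP => // _; rewrite mcoeffZ mcoeffX (negbTE ne) mulr0.
Qed.

Lemma line_lead (B : comNzRingType) (iota : {rmorphism C -> B})
    (u : 'I_n -> B) (v : 'I_n -> C) (F : {mpoly C[n]}) :
  F != 0 -> topval v F != 0 ->
  size (line iota u v F) = msize F /\
  lead_coef (line iota u v F) = iota (topval v F).
Proof.
move=> F0 tv; have ct := coef_line_top iota u v F.
have it : iota (topval v F) != 0 by rewrite fmorph_eq0.
have ms : (0 < msize F)%N by rewrite lt0n msize_poly_eq0.
have sz : size (line iota u v F) = msize F.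
  apply/eqP; rewrite eqn_leq size_line /= -(prednK ms) ltnNge.
  by apply/negP => /(nth_default 0) e; move: it; rewrite -ct e eqxx.
by split=> //; rewrite lead_coefE sz.
Qed.

End LeadingForm.

(** * Minimal polynomials over polynomial rings *)

(** The roots of c can be cancelled one at a time: where c vanishes so does the
    product of G and S, hence one of the two factors, whose coefficients are
    then all divisible by the corresponding linear polynomial. Once c is a
    constant, so is the leading coefficient of G. *)
Lemma gauss_uni (C : closedFieldType) (c : {poly C}) (F G S : {poly {poly C}}) :
  c != 0 -> F \is monic -> c *: F = G * S ->
  forall i, lead_coef G %| G`_i.
Proof.
move: {2}(size c) (leqnn (size c)) => k.
elim: k c G S => [|k IH] c G S; first by rewrite leqn0 size_poly_eq0 => ->.
move=> sc c0 Fm eqc.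
have lcc : c = lead_coef G * lead_coef S.
  by rewrite -lead_coefM -eqc lead_coefZ (monicP Fm) mulr1.
have [/eqP c1|] := boolP (size c == 1)%N.
  move=> i; apply: (@dvdp_trans _ 1); last exact: dvd1p.
  have : lead_coef G %| c by rewrite lcc dvdp_mulr.
  move=> /dvdp_trans; apply.
  by have := size_poly_eq1 c; rewrite c1 eqxx => /esym/andP [].
case/closed_rootP => s0 rc.
have /dvdpP [c' c'E] : ('X - s0%:P) %| c by rewrite dvdp_XsubCl.
have X0 : 'X - s0%:P != 0 by rewrite polyXsubC_eq0.
have c'0 : c' != 0 by apply: contraNneq c0; rewrite c'E => ->; rewrite mul0r.
have sc' : (size c' <= k)%N.
  by move: sc; rewrite c'E size_Mmonic ?monicXsubC // size_XsubC addn2.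
pose e := map_poly (horner_eval s0).
have dv (P : {poly {poly C}}) : e P = 0 ->
   P = ('X - s0%:P) *: map_poly (fun p => p %/ ('X - s0%:P)) P.
  move=> eP; apply/polyP => i; rewrite coefZ coef_map_id0 ?div0p // mulrC divpK //.
  rewrite dvdp_XsubCl rootE -horner_evalE.
  by have /(congr1 (fun q : {poly C} => q`_i)) := eP; rewrite /e coef_map coef0 => ->.
have : e G * e S = 0.
  rewrite /e -rmorphM /= -eqc map_polyZ /= horner_evalE.
  by move: rc; rewrite rootE => /eqP ->; rewrite scale0r.
have cancelX (P Q : {poly {poly C}}) : ('X - s0%:P) *: P = ('X - s0%:P) *: Q -> P = Q.
  by rewrite -!mul_polyC; apply: mulfI; rewrite polyC_eq0.
move=> /eqP; rewrite mulf_eq0 => /orP [] /eqP /dv; set P' := map_poly _ _ => PE.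
  have e' : c' *: F = P' * S.
    by apply: cancelX; rewrite scalerA mulrC -c'E eqc PE scalerAl.
  move=> i; rewrite PE lead_coefZ coefZ dvdp_mul2l //.
  exact: (IH c' P' S).
have e' : c' *: F = G * P'.
  by apply: cancelX; rewrite scalerA mulrC -c'E eqc PE scalerAr.
exact: (IH c' G P').
Qed.

(** This is the integral closedness of a polynomial ring, stated for factors of
    monic polynomials. Along a generic direction v the leading coefficient a of
    G becomes monic up to a constant, so each coefficient of G can be divided by
    a there. The remainder vanishes on every line of direction v, by the case of
    one variable and for degree reasons; hence it is zero, and the quotient
    taken at the origin of the lines is the quotient sought. *)
Lemma gauss (C : numClosedFieldType) (n : nat) (c : {mpoly C[n]})
    (F G S : {poly {mpoly C[n]}}) :
  c != 0 -> F \is monic -> c *: F = G * S ->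
  exists H, G = lead_coef G *: H.
Proof.
move=> c0 Fm eqc; set a := lead_coef G.
have lcc : c = a * lead_coef S.
  by rewrite -lead_coefM -eqc lead_coefZ (monicP Fm) mulr1.
have a0 : a != 0 by apply: contraNneq c0; rewrite lcc => ->; rewrite mul0r.
have [v] : exists v, (topform a * topform c).@[v] != 0.
  by apply: ex_meval_neq0; rewrite mulf_neq0 ?topform_neq0.
rewrite mevalM mulf_eq0 negb_or !meval_topform => /andP [va vc].
pose th := line (@mpolyC n C) (fun i => 'X_i) v.
have [sa la] := line_lead (@mpolyC n C) (fun i => 'X_i) a0 va.
have [_ lc] := line_lead (@mpolyC n C) (fun i => 'X_i) c0 vc.
pose t := topval v a.
pose A := (t^-1)%:MP *: th a.
have t1 : (t^-1)%:MP * t%:MP = 1 :> {mpoly C[n]}.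
  by rewrite -mpolyCM mulVf.
have t0 : (t^-1)%:MP != 0 :> {mpoly C[n]} by rewrite mpolyC_eq0 invr_eq0.
have Am : A \is monic by rewrite monicE lead_coefZ la t1.
pose lx x := line (@idfun C) x v.
have lxE x p : lx x p = map_poly (meval x) (th p).
  rewrite /th (map_line (iota' := idfun)) => [|d]; last exact: mevalC.
  by apply: mmap_ext => // i /=; rewrite mevalXU.
have lxa x : lx x a != 0.
  by have [sz _] := line_lead (@idfun C) x a0 va; rewrite -size_poly_eq0 /lx sz msize_poly_eq0.
have lxc x : lx x c != 0.
  by have [sz _] := line_lead (@idfun C) x c0 vc; rewrite -size_poly_eq0 /lx sz msize_poly_eq0.
have dvd x i : lx x a %| lx x G`_i.
  have := @gauss_uni C (lx x c) (map_poly (lx x) F) (map_poly (lx x) G)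
            (map_poly (lx x) S) (lxc x) (monic_map _ Fm).
  rewrite -map_polyZ -rmorphM eqc => /(_ erefl i).
  by rewrite coef_map lead_coef_map_eq //; exact: lxa.
have mod0 i : rmodp (th G`_i) A = 0.
  apply/eqP; apply: contraTT isT; rewrite -lead_coef_eq0 => l0.
  have [x xP] := ex_meval_neq0 l0.
  set r := rmodp _ _ in l0 xP.
  have rE : th G`_i = rdivp (th G`_i) A * A + r by exact: Pdiv.RingMonic.rdivp_eq.
  have rx0 : map_poly (meval x) r != 0.
    by rewrite -lead_coef_eq0 lead_coef_map_eq.
  have sr : (size (map_poly (meval x) r) < size (map_poly (meval x) A))%N.
    have ->: size (map_poly (meval x) A) = size A.
      by rewrite size_map_poly_id0 // (monicP Am) rmorph1 oner_eq0.
    apply: (leq_ltn_trans (size_poly _ _)).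
    by rewrite ltn_rmodp monic_neq0.
  have AE : map_poly (meval x) A = t^-1 *: lx x a.
    by rewrite /A map_polyZ /= mevalC -lxE.
  have := dvd x i; rewrite [lx x G`_i]lxE rE rmorphD rmorphM /= AE -scalerAr.
  rewrite dvdp_addr ?dvdpZr ?dvdp_mull ?invr_eq0 //.
  move=> /(dvdp_leq rx0); rewrite leqNgt.
  by move: sr; rewrite AE size_scale ?invr_eq0 // => ->.
have [h hE] : {h : nat -> {mpoly C[n]} & forall i, G`_i = a * h i}.
  apply: (@choice _ _ (fun i p => G`_i = a * p)) => i; have := Pdiv.RingMonic.rdivp_eq Am (th G`_i).
  rewrite mod0 addr0 => /(congr1 (horner_eval 0)).
  have ev0 p : (th p).[0] = p.
    rewrite /th horner_line -[RHS]mmap_id; apply: mmap_ext => // j.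
    by rewrite mulr0 addr0.
  rewrite /= !horner_evalE ev0 hornerM hornerZ ev0 => ->.
  by eexists; rewrite mulrA mulrC.
exists (\poly_(i < size G) h i); apply/polyP => i.
by rewrite coefZ coef_poly; case: ltnP => [_|/(nth_default 0) ->]; rewrite ?hE ?mulr0.
Qed.

(** A relation of least degree divides every relation up to a scalar; in
    particular it divides a monic one, so the Gauss lemma allows its leading
    coefficient to be cancelled. *)
Lemma minimal_polynomial (C : numClosedFieldType) (n : nat) (D : comNzRingType)
    (sigma : {rmorphism {mpoly C[n]} -> D}) (w : D) :
  (forall x y : D, x * y = 0 -> x = 0 \/ y = 0) ->
  (forall q, sigma q = 0 -> q = 0) ->
  integralOver sigma w ->
  exists2 G, G \is monic &
    forall Q, root (map_poly sigma Q) w <-> exists S, Q = S * G.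
Proof.
move=> domD injs [F Fm Fw].
pose P k := `[< exists Q, [/\ Q != 0, root (map_poly sigma Q) w & size Q = k] >].
have exP : exists k, P k.
  by exists (size F); apply/asboolP; exists F; split=> //; exact: monic_neq0.
have [Q0 [Q00 Q0w minQ]] : exists Q0, [/\ Q0 != 0, root (map_poly sigma Q0) w &
    forall Q, root (map_poly sigma Q) w -> (size Q < size Q0)%N -> Q = 0]. 
  case: (ex_minnP exP) => k /asboolP [Q0 [? ? sQ]] mink; exists Q0; split=> // Q Qw.
  rewrite sQ => lt; apply/eqP; apply: contraTT lt => Q'0; rewrite -leqNgt.
  by apply: mink; apply/asboolP; exists Q.
pose a := lead_coef Q0.
have a0 : a != 0 by rewrite lead_coef_eq0.
have div0 Q : root (map_poly sigma Q) w -> exists2 k, k != 0 & exists S, k *: Q = S * Q0.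
  move=> Qw; have eqQ := Pdiv.ComRing.rdivp_eq Q0 Q.
  have r0 : rmodp Q Q0 = 0.
    apply: minQ; last by rewrite ltn_rmodp.
    move: Qw Q0w; rewrite !rootE => /eqP Qw /eqP Q0w.
    have := congr1 (horner_eval w \o map_poly sigma) eqQ.
    rewrite /= map_polyZ rmorphD rmorphM /= !horner_evalE hornerZ hornerD hornerM.
    by rewrite Qw Q0w !mulr0 add0r => <-.
  by exists (lead_coef Q0 ^+ rscalp Q Q0); rewrite ?expf_neq0 //;
     exists (rdivp Q Q0); rewrite eqQ r0 addr0.
have [k k0 [S kF]] := div0 F Fw.
have [|G GE] := @gauss C n k F Q0 S k0 Fm; first by rewrite kF mulrC.
have Gm : G \is monic.
  rewrite monicE; apply/eqP/(mulfI a0).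
  by rewrite -lead_coefZ -GE mulr1.
have Gw : root (map_poly sigma G) w.
  move: Q0w; rewrite GE map_polyZ /= !rootE hornerZ => /eqP /domD [|->] //.
  by move/injs/eqP; rewrite (negbTE a0).
exists G => // Q; split=> [Qw|[S' ->]]; last first.
  by move: Gw; rewrite rmorphM !rootE hornerM => /eqP ->; rewrite mulr0.
exists (rdivp Q G); rewrite [LHS](rdivp_eq Gm) [rmodp _ _]minQ ?addr0 //.
  move: Gw Qw; rewrite !rootE {1}(rdivp_eq Gm Q) rmorphD rmorphM /= hornerD hornerM.
  by move=> /eqP ->; rewrite mulr0 add0r.
by rewrite GE size_scale // ltn_rmodp monic_neq0.
Qed.

(** * Specializations along integral extensions *)

Section ExtendPlace.
Variables (C : closedFieldType) (B D : comNzRingType).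
Variables (kappa : {rmorphism C -> B}).
Variables (rho : {rmorphism B -> D}) (phi : {rmorphism B -> C}).
Hypothesis phiK : forall c, phi (kappa c) = c.
Hypothesis ker_le : forall b, rho b = 0 -> phi b = 0.

(** Multiplication by q on the free module of polynomials modulo F has a matrix M
    over B. Under rho it kills the nonzero vector of powers of b, so rho kills
    the determinant of M; under phi it becomes the scalar matrix c, so phi maps
    that determinant to a power of c. *)
Lemma extension_proper (F q : {poly B}) (b : D) (c : C) :
  F \is monic -> (map_poly rho F).[b] = 0 -> (map_poly rho q).[b] = 0 ->
  map_poly phi q = c%:P -> c = 0.
Proof.
move=> Fm Fb qb qc; apply/eqP/negP => /negP c0.
have [m sF] : exists m, size F = m.+2.
  case sF: (size F) => [|[|m]]; last by exists m.
    by have := monic_neq0 Fm; rewrite -size_poly_eq0 sF.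
  have F1 : F = 1.
    rewrite [F]size1_polyC ?sF //; move: (monicP Fm).
    by rewrite lead_coefE sF /= => ->.
  by move/eqP: Fb; rewrite F1 rmorph1 hornerC oner_eq0.
pose r i := rmodp ('X^i * q) F.
have sr i : (size (r i) <= m.+1)%N.
  by rewrite -ltnS -sF ltn_rmodp monic_neq0.
have rb i : (map_poly rho (r i)).[b] = 0.
  have /(congr1 (horner_eval b \o map_poly rho)) := rdivp_eq Fm ('X^i * q).
  rewrite /= rmorphD !rmorphM /= !horner_evalE hornerD !hornerM Fb qb !mulr0.
  by rewrite add0r => <-.
have rc i : (i < m.+1)%N -> map_poly phi (r i) = c *: 'X^i.
  move=> im; have Fpm : map_poly phi F \is monic by exact: monic_map.
  have sFp : size (map_poly phi F) = m.+2.
    by rewrite size_map_poly_id0 ?sF // (monicP Fm) rmorph1 oner_eq0.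
  have /(congr1 (map_poly phi)) := rdivp_eq Fm ('X^i * q).
  rewrite rmorphD !rmorphM /= qc map_polyXn mulrC mul_polyC => eqc.
  have := rmodp_small (p := c *: 'X^i) (q := map_poly phi F).
  rewrite size_scale // size_polyXn sFp ltnS => /(_ im) <-.
  by rewrite eqc rmodp_addl_mul_small // sFp ltnS (leq_trans (size_poly _ _)) //; exact: sr.
pose M : 'M[B]_m.+1 := \matrix_(i, j) (r i)`_j.
have Mb : map_mx rho M *m (\col_j b ^+ j) = 0.
  apply/matrixP => i j; rewrite !mxE -[RHS](rb i).
  rewrite (@horner_coef_wide _ m.+1) ?(leq_trans (size_poly _ _)) //.
  by apply: eq_bigr => k _; rewrite !mxE coef_map.
have d0 : rho (\det M) = 0.
  have /(congr1 (mulmx (\adj (map_mx rho M)))) := Mb.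
  rewrite mulmx0 mulmxA mul_adj_mx mul_scalar_mx => /matrixP /(_ ord0 ord0).
  by rewrite !mxE expr0 mulr1 det_map_mx.
have /eqP := ker_le d0; rewrite -det_map_mx.
have -> : map_mx phi M = c%:M.
  apply/matrixP => i j; rewrite !mxE -coef_map rc // coefZ coefXn.
  by rewrite eq_sym mulr_natr.
by rewrite det_scalar expf_eq0 (negbTE c0).
Qed.

(** The relations satisfied by b specialize to an ideal of the principal ring
    of polynomials over C; a common root exists unless a relation specializes
    to a nonzero constant. *)
Lemma extend_place (b : D) : integralOver rho b ->
  exists beta, forall q : {poly B},
    (map_poly rho q).[b] = 0 -> (map_poly phi q).[beta] = 0.
Proof.
case=> F Fm; rewrite rootE => /eqP Fb.
pose rel q := (map_poly rho q).[b] = 0.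
pose P k := `[< exists q, [/\ rel q, map_poly phi q != 0 & size (map_poly phi q) = k] >].
have exP : exists k, P k.
  exists (size (map_poly phi F)); apply/asboolP; exists F; split=> //.
  by rewrite monic_neq0 // monic_map.
case: (ex_minnP exP) => k /asboolP [g [gb g0 sg]] mink.
have dvg q : rel q -> map_poly phi g %| map_poly phi q.
  move=> qb; rewrite /dvdp; apply/negPn/negP => r0.
  have phiKp p : map_poly phi (map_poly kappa p) = p.
    by rewrite -map_poly_comp map_poly_id // => x _ /=; rewrite phiK.
  pose q' := q - map_poly kappa (map_poly phi q %/ map_poly phi g) * g.
  have q'E : map_poly phi q' = map_poly phi q %% map_poly phi g.
    rewrite rmorphB rmorphM /= phiKp {1}(divp_eq (map_poly phi q) (map_poly phi g)).
    by rewrite addrC addKr.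
  have : P (size (map_poly phi q')).
    apply/asboolP; exists q'; rewrite q'E; split=> //.
    by rewrite /rel rmorphB rmorphM /= hornerD hornerN hornerM gb qb mulr0 subrr.
  by move=> /mink; rewrite q'E leqNgt -sg ltn_modp g0.
have [/eqP s1|/closed_rootP [beta rb]] := boolP (size (map_poly phi g) == 1)%N.
  have gc : map_poly phi g = ((map_poly phi g)`_0)%:P by apply: size1_polyC; rewrite s1.
  have c0 := extension_proper Fm Fb gb gc.
  by move: g0; rewrite gc c0 eqxx.
exists beta => q /dvg /dvdpP [s ->]; rewrite hornerM.
by move: rb; rewrite rootE => /eqP ->; rewrite mulr0.
Qed.

End ExtendPlace.

(** The ring B grows by one polynomial variable for each element of s; the maps
    rho' and phi' describe a specialization of the subring generated by the
    image of B and by s. *)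
Lemma lift_place (C : closedFieldType) (D : comNzRingType) (s : seq D)
    (B : comNzRingType) (kappa : {rmorphism C -> B})
    (rho : {rmorphism B -> D}) (phi : {rmorphism B -> C}) :
  (forall c, phi (kappa c) = c) ->
  (forall b, rho b = 0 -> phi b = 0) ->
  (forall x, x \in s -> integralOver rho x) ->
  exists (B' : comNzRingType) (j : {rmorphism B -> B'})
         (rho' : {rmorphism B' -> D}) (phi' : {rmorphism B' -> C}),
  [/\ forall b, rho' b = 0 -> phi' b = 0,
      forall b, rho' (j b) = rho b,
      forall b, phi' (j b) = phi b &
      forall x, x \in s -> exists b, rho' b = x].
Proof.
elim: s B kappa rho phi => [|x s IH] B kappa rho phi phiK ker ints.
  by exists B, idfun, rho, phi; split.
have [|beta betaP] := extend_place phiK ker (b := x).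
  by apply: ints; rewrite mem_head.
pose rho1 := horner_eval x \o map_poly rho.
pose phi1 := horner_eval beta \o map_poly phi.
pose kappa1 := @polyC B \o kappa.
have rho1C b : rho1 b%:P = rho b by rewrite /rho1 /= map_polyC horner_evalE hornerC.
have phi1C b : phi1 b%:P = phi b by rewrite /phi1 /= map_polyC horner_evalE hornerC.
have [|||B' [j [rho' [phi' [ker' rj phij gens]]]]] :=
  IH {poly B} kappa1 rho1 phi1.
- by move=> c; rewrite /kappa1 [LHS]phi1C phiK.
- exact: betaP.
- move=> y ys; have [F Fm Fy] := ints y (mem_behead (s := x :: s) ys).
  exists (map_poly polyC F); first exact: monic_map.
  by rewrite -map_poly_comp (eq_map_poly (g := rho)).
exists B', (j \o @polyC B), rho', phi'; split=> // [b|b|y].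
- by rewrite [LHS]rj; apply: rho1C.
- by rewrite [LHS]phij; apply: phi1C.
rewrite inE => /orP [/eqP ->|/gens//]; exists (j 'X); rewrite rj /rho1 /=.
by rewrite map_polyX horner_evalE hornerX.
Qed.

Lemma integral_mmap (C R D : comNzRingType) (iota : {rmorphism C -> D})
    (sigma : {rmorphism R -> D}) (n : nat) (xi : 'I_n -> D) (p : {mpoly C[n]}) :
  (forall c, integralOver sigma (iota c)) ->
  (forall i, integralOver sigma (xi i)) -> integralOver sigma (mmap iota xi p).
Proof.
move=> intc intxi; rewrite /mmap.
elim/big_ind: _ => [|x y|m _]; [exact: integral0|exact: integral_add|].
apply: integral_mul => //; rewrite /mmap1.
elim/big_ind: _ => [|x y|i _]; [exact: integral1|exact: integral_mul|].
elim: (m i) => [|k IH]; first by rewrite expr0; exact: integral1.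
by rewrite exprS; apply: integral_mul.
Qed.

Lemma integral_trans (R S D : comNzRingType) (sigma : {rmorphism R -> D})
    (tau : {rmorphism S -> D}) (x : D) :
  (forall s, integralOver sigma (tau s)) -> integralOver tau x ->
  integralOver sigma x.
Proof.
move=> ints [F Fm Fx]; apply: (integral_root_monic (p := map_poly tau F)) => //.
  exact: monic_map.
by apply/integral_poly => i; rewrite coef_map; apply: ints.
Qed.

(** If the xi satisfy a relation F, subtract from all but the last one suitable
    multiples of the last one: when the direction v of this change of
    coordinates is not a zero of the leading form of F, the relation becomes
    monic in the last coordinate, which is then integral over the others. *)
Lemma noether_normalization (C : numFieldType) (D : comNzRingType)
    (iota : {rmorphism C -> D}) (n : nat) (xi : 'I_n -> D) :
  exists d (Y : 'I_d -> {mpoly C[n]}), let y j := mmap iota xi (Y j) in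
    (forall q, mmap iota y q = 0 -> q = 0) /\
    (forall i, integralOver (mmap iota y) (xi i)).
Proof.
elim: n xi => [|n IH] xi.
  exists 0%N, (fun j => 'X_j); split=> [q|[]//].
  have -> : q = (q@_0)%:MP.
    by apply: msize1_polyC; rewrite msizeE; apply/bigmax_leqP_seq => m _ _;
       rewrite mdegE big_ord0.
  by rewrite mmapC => /eqP; rewrite fmorph_eq0 => /eqP ->; rewrite mpolyC0.
have [indep|] := pselect (forall q, mmap iota xi q = 0 -> q = 0).
  exists n.+1, (fun j => 'X_j) => y.
  have -> : y = xi by apply/funext => i; rewrite /y mmapX mmap1U.
  split=> // i; have -> : xi i = mmap iota xi 'X_i by rewrite mmapX mmap1U.
  exact: integral_id.
move=> /existsNP [F /not_implyP [Fxi /eqP F0]].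
have [v] : exists v, (topform F * 'X_ord_max).@[v] != 0.
  apply: ex_meval_neq0; rewrite mulf_neq0 ?topform_neq0 //.
  by rewrite -msize_poly_eq0 msizeX.
rewrite mevalM mevalXU meval_topform mulf_eq0 negb_or => /andP [tv l0].
pose l := v ord_max; pose t := iota l^-1 * xi ord_max.
pose xi' (j : 'I_n) := xi (lift ord_max j) - iota (v (lift ord_max j)) * t.
pose L (j : 'I_n) : {mpoly C[n.+1]} :=
  'X_(lift ord_max j) - (v (lift ord_max j) * l^-1) *: 'X_ord_max.
have Lxi j : mmap iota xi (L j) = xi' j.
  rewrite /L rmorphB /= mmapZ !mmapX !mmap1U /xi' /t rmorphM.
  by rewrite mulrA.
have [d [Y' [indep int']]] := IH xi'.
pose Y j := mmap (@mpolyC n.+1 C) L (Y' j).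
have YE j : mmap iota xi (Y j) = mmap iota xi' (Y' j).
  rewrite /Y rmorph_mmap; apply: mmap_ext => i /=; last exact: Lxi.
  by rewrite mmapC.
exists d, Y => y; have -> : y = fun j => mmap iota xi' (Y' j) by apply/funext.
split=> // i; set y' := fun j => _.
have intc c : integralOver (mmap iota y') (iota c).
  by rewrite -(mmapC y'); apply: integral_id.
apply: (integral_trans (tau := mmap iota xi')).
  by move=> p; apply: integral_mmap.
have intc' c : integralOver (mmap iota xi') (iota c).
  by rewrite -(mmapC xi'); apply: integral_id.
have intx' j : integralOver (mmap iota xi') (xi' j).
  have -> : xi' j = mmap iota xi' 'X_j by rewrite mmapX mmap1U.
  exact: integral_id.
have intt : integralOver (mmap iota xi') t.
  pose u (i : 'I_n.+1) : {mpoly C[n]} := if unlift ord_max i is Some j then 'X_j else 0.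
  have [_ lQ] := line_lead (@mpolyC n C) u F0 tv.
  exists (((topval v F)^-1)%:MP *: line (@mpolyC n C) u v F).
    by rewrite monicE lead_coefZ lQ -mpolyCM mulVf.
  rewrite rootE map_polyZ hornerZ (map_line (iota' := iota)) => [|c]; last first.
    exact: mmapC.
  rewrite horner_line (mmap_ext (f' := iota) (h' := xi)) ?Fxi ?mulr0 // => k.
  rewrite /u /=; case: unliftP => [j ->|->].
    by rewrite mmapX mmap1U /xi' subrK.
  by rewrite rmorph0 add0r /t mulrA -rmorphM divff // rmorph1 mul1r.
have -> : xi i = mmap iota xi' (if unlift ord_max i is Some j then 'X_j else 0)
                 + iota (v i) * t.
  case: unliftP => [j ->|->]; first by rewrite mmapX mmap1U /xi' subrK.
  by rewrite rmorph0 add0r /t mulrA -rmorphM divff // rmorph1 mul1r.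
by apply: integral_add; [exact: integral_id | exact: integral_mul].
Qed.

(** * Specializations near a point *)

(** Lying over: a specialization (y, w) |-> (y1, t) of the base, of which the
    second hypothesis says that it is compatible with all relations, extends to
    the elements xi integral over y. *)
Lemma lift_point (C : closedFieldType) (D : comNzRingType)
    (iota : {rmorphism C -> D}) (n d : nat) (xi : 'I_n -> D) (y : 'I_d -> D)
    (w : D) (y1 : 'I_d -> C) (t : C) :
  (forall i, integralOver (mmap iota y) (xi i)) ->
  (forall Q, root (map_poly (mmap iota y) Q) w ->
             root (map_poly (meval y1) Q) t) ->
  exists z : 'I_n -> C,
    (forall q p, root (map_poly (mmap iota y) q) (mmap iota xi p) ->
                 root (map_poly (meval y1) q) p.@[z]) /\
    (forall p, mmap iota xi p = w -> p.@[z] = t).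
Proof.
move=> intxi spec.
pose kappa0 := @polyC {mpoly C[d]} \o @mpolyC d C.
pose rho0 := horner_eval w \o map_poly (mmap iota y).
pose phi0 := horner_eval t \o map_poly (meval y1).
have rho0C q : rho0 q%:P = mmap iota y q.
  by rewrite /rho0 /= map_polyC horner_evalE hornerC.
have phi0C q : phi0 q%:P = q.@[y1].
  by rewrite /phi0 /= map_polyC horner_evalE hornerC.
have [|||B' [j [rho [phi [ker rhoj phij gens]]]]] :=
  @lift_place C D [seq xi i | i <- enum 'I_n] _ kappa0 rho0 phi0.
- by move=> c; rewrite /kappa0 [LHS]phi0C mevalC.
- by move=> Q /eqP Qw; apply/eqP; apply: spec.
- move=> x /mapP [i _ ->]; have [F Fm Fx] := intxi i.
  exists (map_poly polyC F); first exact: monic_map.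
  by rewrite -map_poly_comp (eq_map_poly (g := mmap iota y)).
have [b bE] : {b : 'I_n -> B' & forall i, rho (b i) = xi i}.
  apply: (@choice _ _ (fun i b => rho b = xi i)) => i.
  by apply: gens; apply: map_f; rewrite mem_enum.
pose kappa := j \o kappa0.
pose el p := mmap kappa b p.
have rhoel p : rho (el p) = mmap iota xi p.
  rewrite /el rmorph_mmap; apply: mmap_ext => // c.
  by rewrite /kappa /= rhoj [LHS]rho0C mmapC.
pose z i := phi (b i).
have phiel p : phi (el p) = p.@[z].
  rewrite /el rmorph_mmap; apply: mmap_ext => // c.
  by rewrite /kappa /= phij [LHS]phi0C mevalC.
exists z; split=> [q p|p pw].
  pose e := (map_poly (j \o polyC) q).[el p].
  have rhoe : rho e = (map_poly (mmap iota y) q).[mmap iota xi p].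
    rewrite /e -horner_map rhoel -map_poly_comp; congr (horner _ _).
    by apply: eq_map_poly => c /=; rewrite rhoj; apply: rho0C.
  have phie : phi e = (map_poly (meval y1) q).[p.@[z]].
    rewrite /e -horner_map phiel -map_poly_comp; congr (horner _ _).
    by apply: eq_map_poly => c /=; rewrite phij; apply: phi0C.
  by rewrite !rootE -rhoe -phie => /eqP /ker /eqP.
have : rho (el p - j 'X) = 0.
  by rewrite rmorphB rhoj rhoel pw /rho0 /= map_polyX horner_evalE hornerX subrr.
move=> /ker /eqP; rewrite rmorphB phij phiel /phi0 /= map_polyX horner_evalE.
by rewrite hornerX subr_eq0 => /eqP.
Qed.

Section Estimates.
Variable C : numClosedFieldType.

Definition near0 (P : C -> Prop) := exists2 d, 0 < d & forall s, `|s| < d -> P s.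

Lemma near0_and (P Q : C -> Prop) :
  near0 P -> near0 Q -> near0 (fun s => P s /\ Q s).
Proof.
move=> [d d0 dP] [e e0 eQ].
have [de|ed] := real_leP (gtr0_real d0) (gtr0_real e0).
  by exists d => // s sd; split; [exact: dP|apply: eQ; exact: lt_le_trans de].
by exists e => // s sd; split; [apply: dP; exact: lt_trans ed|exact: eQ].
Qed.

Lemma near0_forall (I : finType) (P : I -> C -> Prop) :
  (forall i, near0 (P i)) -> near0 (fun s => forall i, P i s).
Proof.
move=> nP; suff [d d0 dP] : near0 (fun s => forall i, i \in enum I -> P i s).
  by exists d => // s sd i; apply: dP => //; rewrite mem_enum.
elim: (enum I) => [|i r IH]; first by exists 1 => // s _ i; rewrite in_nil.
have [d d0 dP] := near0_and (nP i) IH; exists d => // s /dP [Pi Pr] k.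
by rewrite inE => /orP [/eqP ->|/Pr].
Qed.

(** Q is a polynomial in x with coefficients depending polynomially on s. *)
Definition eval2 (Q : {poly {poly C}}) (s x : C) := (map_poly (horner_eval s) Q).[x].

Lemma eval2_bounded Q (M : C) :
  exists2 K, 0 < K & forall s x, `|s| <= 1 -> `|x| <= M -> `|eval2 Q s x| <= K.
Proof.
pose b i := sval (poly_disk_bound Q`_i 1).
exists (1 + \sum_(i < size Q) `|b i| * `|M| ^+ i).
  apply: ltr_wpDr => //; apply: sumr_ge0 => i _.
  by rewrite mulr_ge0 ?exprn_ge0.
move=> s x s1 xM; rewrite /eval2 (@horner_coef_wide _ (size Q)) ?size_poly //.
apply: ler_wpDl => //; apply: (le_trans (ler_norm_sum _ _ _)).
apply: ler_sum => i _; rewrite coef_map /= normrM normrX ler_pM ?exprn_ge0 //.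
  have := svalP (poly_disk_bound Q`_i 1) s s1; rewrite -/(b i) horner_evalE.
  by move=> h; rewrite (le_trans h) // real_ler_norm // ger0_real // (le_trans _ h).
by rewrite lerXn2r ?nnegrE // (le_trans xM) // real_ler_norm // ger0_real // (le_trans _ xM).
Qed.

(** The difference is s times a polynomial in s and x. *)
Lemma eval2_cont Q (M eta : C) : 0 < eta ->
  near0 (fun s => forall x, `|x| <= M -> `|eval2 Q s x - eval2 Q 0 x| < eta).
Proof.
move=> eta0.
pose Q' := map_poly (fun p => (p - (p.[0])%:P) %/ 'X) Q.
have [K K0 Kb] := eval2_bounded Q' M.
have eqQ s x : eval2 Q s x - eval2 Q 0 x = s * eval2 Q' s x.
  rewrite /eval2 -hornerN -hornerD -hornerZ; congr (horner _ _).
  apply/polyP => i; rewrite coefD coefN coefZ !coef_map /= !horner_evalE.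
  rewrite coef_map_id0; last by rewrite horner0 subr0 div0p.
  set p := Q`_i; have /divpK : 'X %| p - (p.[0])%:P.
    by rewrite -['X]subr0 -polyC0 dvdp_XsubCl rootE !hornerE subrr.
  by move=> /(congr1 (horner^~ s)); rewrite hornerM hornerX mulrC !hornerE => ->.
exists (eta / (K + eta)); first by rewrite divr_gt0 ?addr_gt0.
move=> s sd x xM; rewrite eqQ normrM.
have s1 : `|s| <= 1.
  by apply: (le_trans (ltW sd)); rewrite ler_pdivrMr ?addr_gt0 // mul1r lerDr ltW.
apply: (le_lt_trans (ler_wpM2l (normr_ge0 _) (Kb s x s1 xM))).
apply: (lt_le_trans (y := eta / (K + eta) * K)); first by rewrite ltr_pM2r.
by rewrite -mulrA ler_piMr ?(ltW eta0) // mulrC ler_pdivrMr ?addr_gt0 // mul1r lerDl ltW.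
Qed.

Lemma monic_root_bound (P : {poly C}) (x : C) : P \is monic -> root P x ->
  `|x| <= 1 + \sum_(i < (size P).-1) `|P`_i|.
Proof.
move=> Pm; rewrite rootE horner_coef polySpred ?monic_neq0 //=.
set m := (size P).-1.
rewrite big_ord_recr /= -lead_coefE (monicP Pm) mul1r addrC addr_eq0 => /eqP xm.
have S0 : 0 <= \sum_(i < m) `|P`_i| by apply: sumr_ge0.
have [x1|x1] := real_leP (normr_real x) (@real1 C).
  by rewrite (le_trans x1) // lerDl.
case: m xm S0 => [|m] xm S0.
  by move: xm => /eqP; rewrite expr0 big_ord0 oppr0 oner_eq0.
apply: ler_wpDl => //; have x0 : 0 < `|x| ^+ m by rewrite exprn_gt0 // (lt_trans ltr01).
rewrite -(ler_pM2r x0) -exprS -normrX xm normrN mulr_suml.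
apply: (le_trans (ler_norm_sum _ _ _)); apply: ler_sum => i _.
rewrite normrM normrX ler_wpM2l // ler_weXn2l // ?(ltW x1) //.
by rewrite -ltnS.
Qed.

Lemma eval2_root_bound (Q : {poly {poly C}}) : Q \is monic ->
  exists M, forall s x, `|s| <= 1 -> eval2 Q s x = 0 -> `|x| <= M.
Proof.
move=> Qm; pose b i := sval (poly_disk_bound Q`_i 1).
exists (1 + \sum_(i < (size Q).-1) b i) => s x s1 /eqP xr.
have Pm : map_poly (horner_eval s) Q \is monic by exact: monic_map.
apply: (le_trans (monic_root_bound Pm xr)); rewrite lerD2l.
rewrite size_map_poly_id0; last by rewrite (monicP Qm) rmorph1 oner_eq0.
apply: ler_sum => i _; rewrite coef_map /= horner_evalE.
exact: svalP (poly_disk_bound Q`_i 1) s s1.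
Qed.

(** The modulus of P at w is the product of the distances from w to the
    roots. *)
Lemma ex_near_root (P : {poly C}) (w eta : C) : P \is monic -> 0 < eta ->
  (1 < size P)%N -> `|P.[w]| < eta ^+ (size P).-1 ->
  exists2 t, root P t & `|t - w| < eta.
Proof.
move=> Pm eta0 sP; have [r] := closed_field_poly_normal P.
rewrite (monicP Pm) scale1r => PE Pw; apply: contrapT => H.
move: Pw; rewrite PE size_prod_XsubC /= horner_prod normr_prod.
suff le : eta ^+ size r <= \prod_(z <- r) `|('X - z%:P).[w]|.
  by move=> /(le_lt_trans le); rewrite ltxx.
have {}H z : z \in r -> eta <= `|w - z|.
  move=> zr; have [//|lt] := real_leP (gtr0_real eta0) (normr_real (w - z)).
  by case: H; exists z; rewrite ?PE ?root_prod_XsubC // distrC.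
have -> : eta ^+ size r = \prod_(z <- r) eta by rewrite big_const_seq count_predT iter_mulr_1.
rewrite !big_seq; apply: ler_prod => z /H zr; rewrite !hornerE zr andbT.
exact: ltW.
Qed.

End Estimates.

(** If the constant term of the minimal polynomial vanished, dividing by the
    variable would give a relation of smaller degree. *)
Lemma minimal_polynomial_coef0 (C : numClosedFieldType) (n : nat)
    (D : comNzRingType) (sigma : {rmorphism {mpoly C[n]} -> D}) (w : D) :
  (forall x y : D, x * y = 0 -> x = 0 \/ y = 0) ->
  (forall q, sigma q = 0 -> q = 0) ->
  integralOver sigma w -> w != 0 ->
  exists2 E : {poly {mpoly C[n]}}, E`_0 != 0 & root (map_poly sigma E) w.
Proof.
move=> domD injs intw w0; have [E Em Ew] := minimal_polynomial domD injs intw.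
have Ew' : root (map_poly sigma E) w by apply/Ew; exists 1; rewrite mul1r.
exists E => //; rewrite -horner_coef0; apply/negP => /factor_theorem [q qE].
have qw : root (map_poly sigma q) w.
  move: Ew'; rewrite qE rmorphM /= rmorphB /= map_polyX map_polyC /= rmorph0 subr0.
  rewrite !rootE hornerM hornerX => /eqP /domD [->//|w00].
  by rewrite w00 eqxx in w0.
have [S qS] := (Ew q).1 qw.
have E0 := monic_neq0 Em.
have q0 : q != 0 by apply: contraNneq E0 => q0; rewrite qE q0 mul0r.
have S0 : S != 0 by apply: contraNneq q0 => S0; rewrite qS S0 mul0r.
have : size E = (size q).+1 by rewrite {1}qE size_Mmonic ?monicXsubC // size_XsubC addn2.
rewrite qS size_Mmonic //; move: S0; rewrite -size_poly_gt0.
case: (size S) => // k _; rewrite addSn /= => e.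
by have := leq_addl k (size E); rewrite -ltnS -e ltnn.
Qed.

(** Geometrically, xi is the generic point of an irreducible variety through z0.
    Let y be a Noether normalization and y0 its value at z0. Each xi i is a root
    of a monic F i over C[y], and F i at y0 is (x - z0 i) ^ m times a polynomial
    H i nonzero at z0 i. Let w be the product of the H i (xi i), and G its minimal
    polynomial over C[y], which is monic. For y1 close to y0, the polynomial G at
    y1 has a root t close to the value w0 of w at z0, and (y, w) |-> (y1, t)
    extends to a point z. There each H i (z i) is bounded below, since their
    product t is close to w0 and they are bounded above; and F i at y0 is small
    at z i, since F i at y1 vanishes there. So z i is close to z0 i. The point y1
    moves on a line through y0 not contained in the zero set of the constant term
    of a relation satisfied by g, which ensures that g is nonzero at z. *)
Lemma specialization_near (C : numClosedFieldType) (D : comNzRingType)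
    (iota : {rmorphism C -> D}) (n : nat) (xi : 'I_n -> D) (z0 : 'I_n -> C)
    (g : {mpoly C[n]}) (eps : C) :
  (forall x y : D, x * y = 0 -> x = 0 \/ y = 0) ->
  (forall p, mmap iota xi p = 0 -> p.@[z0] = 0) ->
  mmap iota xi g != 0 -> 0 < eps ->
  exists z : 'I_n -> C,
    [/\ forall p, mmap iota xi p = 0 -> p.@[z] = 0,
        g.@[z] != 0 & forall i, `|z i - z0 i| < eps].
Proof.
move=> domD spec0 g0 eps0.
have [d [Y [indep intxi]]] := noether_normalization iota xi.
set y := (fun j => _) in indep intxi.
pose sigma := mmap iota y; pose y0 j := (Y j).@[z0].
have intp p : integralOver sigma (mmap iota xi p).
  apply: (@integral_mmap C _ D iota (mmap iota y)) => // c.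
  by rewrite -(mmapC y); apply: integral_id.
have spec q p : root (map_poly sigma q) (mmap iota xi p) ->
    root (map_poly (meval y0) q) p.@[z0].
  pose compY := mmap (@mpolyC n C) Y.
  have cD a : mmap iota xi (compY a) = sigma a.
    rewrite /compY rmorph_mmap; apply: mmap_ext => // c; exact: mmapC.
  have cC a : (compY a).@[z0] = a.@[y0].
    rewrite /compY rmorph_mmap; apply: mmap_ext => // c; exact: mevalC.
  have := spec0 (map_poly compY q).[p]; rewrite -!horner_map -!map_poly_comp.
  rewrite (eq_map_poly (g := sigma)) // (eq_map_poly (g := meval y0)) //.
  by move=> h; rewrite !rootE => /eqP /h ->.
have [F FP] : {F : 'I_n -> {poly {mpoly C[d]}} & forall i,
    F i \is monic /\ root (map_poly sigma (F i)) (xi i)}.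
  apply: (@choice _ _ (fun i F => F \is monic /\ root (map_poly sigma F) (xi i))) => i.
  by have [P Pm Pr] := intxi i; exists P.
have xiE i : xi i = mmap iota xi 'X_i by rewrite mmapX mmap1U.
have Fm i := (FP i).1.
have F0m i : map_poly (meval y0) (F i) \is monic by apply: monic_map.
have [H HP] : {H : 'I_n -> nat * {poly C} & forall i,
    ~~ root (H i).2 (z0 i) /\
    map_poly (meval y0) (F i) = (H i).2 * ('X - (z0 i)%:P) ^+ (H i).1}.
  apply: (@choice _ _ (fun i (H : nat * {poly C}) => ~~ root H.2 (z0 i) /\
    map_poly (meval y0) (F i) = H.2 * ('X - (z0 i)%:P) ^+ H.1)) => i.
  have [k [q]] := multiplicity_XsubC (map_poly (meval y0) (F i)) (z0 i).
  by rewrite monic_neq0 //= => nr e; exists (k, q).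
pose W : {mpoly C[n]} := \prod_i (map_poly (@mpolyC n C) (H i).2).['X_i].
have WE z : W.@[z] = \prod_i (H i).2.[z i].
  rewrite /W rmorph_prod; apply: eq_bigr => i _.
  rewrite -horner_map /= mevalXU -map_poly_comp map_poly_id // => c _ /=.
  exact: mevalC.
pose w := mmap iota xi W; pose w0 := W.@[z0].
have w00 : w0 != 0.
  by rewrite /w0 WE; apply/prodf_neq0 => i _; have [] := HP i.
have [G Gm Gw] := minimal_polynomial domD indep (intp W).
have Gw0 : root (map_poly (meval y0) G) w0.
  by apply: spec; apply/Gw; exists 1; rewrite mul1r.
have [E E0 Eg] := minimal_polynomial_coef0 domD indep (intp g) g0.
have [v1 v1P] := ex_meval_neq0 E0.
(* The line through y0 with direction v reaches at time 1 the point v1, where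
   the constant term of E is nonzero. *)
pose v i := v1 i - y0 i.
pose ell := line idfun y0 v; pose ys s i := y0 i + v i * s.
have ellE s p : (ell p).[s] = p.@[ys s] by rewrite /ell horner_line.
have ell0 : ell E`_0 != 0.
  apply: contraNneq v1P => /(congr1 (horner^~ 1)) /=; rewrite ellE horner0 => <-.
  by apply/eqP; apply: meval_eq => i; rewrite /ys /v mulr1 addrC subrK.
have eval2E Q s x : eval2 (map_poly ell Q) s x = (map_poly (meval (ys s)) Q).[x].
  rewrite /eval2 -map_poly_comp; congr (horner _ _); apply: eq_map_poly => p /=.
  by rewrite horner_evalE ellE.
have ys0 : ys 0 = y0 by apply/funext => i; rewrite /ys mulr0 addr0.
have [M MP] : {M : 'I_n -> C & forall i s x, `|s| <= 1 ->
    eval2 (map_poly ell (F i)) s x = 0 -> `|x| <= M i}.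
  apply: (@choice _ _ (fun i M => forall s x, `|s| <= 1 ->
    eval2 (map_poly ell (F i)) s x = 0 -> `|x| <= M)) => i.
  by apply: eval2_root_bound; apply: monic_map.
pose b i := sval (poly_disk_bound (H i).2 (M i)).
pose K := 1 + \sum_i `|b i|.
have K1 : 1 <= K by rewrite lerDl sumr_ge0.
have bK i x : `|x| <= M i -> `|(H i).2.[x]| <= K.
  move=> /(svalP (poly_disk_bound (H i).2 (M i))); rewrite -/(b i) => h.
  apply: (le_trans h); apply: (le_trans (y := `|b i|)).
    by rewrite real_ler_norm // ger0_real // (le_trans _ h).
  by rewrite /K (bigD1 i) //= addrCA lerDl addr_ge0 ?sumr_ge0.
have w0n : 0 < `|w0| by rewrite normr_gt0.
(* Lower bound for |H i (z i)|: the product is at least |w0| / 2 and each of the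
   other factors is at most K. *)
pose c := `|w0| / 2%:R / K ^+ n.
have Kn0 : 0 < K ^+ n by rewrite exprn_gt0 // (lt_le_trans ltr01).
have c0 : 0 < c by rewrite !divr_gt0 ?ltr0n.
pose k i := (H i).1.
have [dl dl0 dlP] : near0 (fun s => (`|s| <= 1 /\
    (forall x, `|x| <= `|w0| -> `|eval2 (map_poly ell G) s x - eval2 (map_poly ell G) 0 x|
        < (`|w0| / 2%:R) ^+ (size G).-1)) /\
    forall i x, `|x| <= M i ->
      `|eval2 (map_poly ell (F i)) s x - eval2 (map_poly ell (F i)) 0 x| < c * eps ^+ k i).
  apply: near0_and; first apply: near0_and.
  - by exists 1 => // s /ltW.
  - by apply: eval2_cont; rewrite exprn_gt0 ?divr_gt0 ?ltr0n.
  - apply: near0_forall => i; apply: eval2_cont.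
    by rewrite mulr_gt0 ?exprn_gt0.
have [s [/dlP [[s1 Gs] Fs] sN]] := ex_small_nonroot ell0 dl0.
have Gsm : map_poly (meval (ys s)) G \is monic by apply: monic_map.
have sGs : size (map_poly (meval (ys s)) G) = size G.
  by rewrite size_map_poly_id0 // (monicP Gm) rmorph1 oner_eq0.
have sG : (1 < size G)%N.
  rewrite -(size_map_poly_id0 (f := meval y0)); last by rewrite (monicP Gm) rmorph1 oner_eq0.
  by apply: root_size_gt1 Gw0; apply: monic_neq0; apply: monic_map.
have [t Gt tw] : exists2 t, root (map_poly (meval (ys s)) G) t & `|t - w0| < `|w0| / 2%:R.
  apply: ex_near_root => //; rewrite ?sGs ?divr_gt0 ?ltr0n //.
  have := Gs w0 (lexx _); rewrite !eval2E ys0.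
  by move: Gw0; rewrite rootE => /eqP ->; rewrite subr0.
have [z [zspec zW]] : exists z : 'I_n -> C,
    (forall q p, root (map_poly sigma q) (mmap iota xi p) ->
                 root (map_poly (meval (ys s)) q) p.@[z]) /\
    (forall p, mmap iota xi p = w -> p.@[z] = t).
  apply: lift_point => // Q /Gw [S ->]; rewrite rmorphM rootM /=.
  by rewrite Gt orbT.
exists z; split.
- move=> p p0; have := zspec 'X p; rewrite !map_polyX !rootE !hornerX p0 eqxx.
  by move=> /(_ isT) /eqP.
- apply: contraNneq sN => gz0; have := zspec E g Eg.
  by rewrite gz0 rootE horner_coef0 coef_map ellE.
move=> i.
have Fz j : eval2 (map_poly ell (F j)) s (z j) = 0.
  have := zspec (F j) 'X_j; rewrite -xiE mevalXU rootE eval2E => /(_ (FP j).2).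
  by rewrite rootE => /eqP.
have zM j : `|z j| <= M j by apply: MP s1 (Fz j).
have tW : `|w0| / 2%:R <= \prod_j `|(H j).2.[z j]|.
  rewrite -normr_prod -WE zW //.
  have tri := ler_normD t (w0 - t); rewrite addrC subrK in tri.
  rewrite -(lerD2r (`|w0| / 2%:R)) -splitr.
  by rewrite (le_trans tri) // lerD2l distrC ltW.
have Hc : c <= `|(H i).2.[z i]|.
  rewrite /c ler_pdivrMr //; apply: (le_trans tW).
  rewrite (bigD1 i) //= ler_wpM2l //.
  apply: (le_trans (y := \prod_(j < n | j != i) K)).
    by apply: ler_prod => j _; rewrite normr_ge0 bK.
  rewrite prodr_const; apply: ler_weXn2l => //.
  by rewrite (leq_trans (max_card _)) ?card_ord.
have := Fs i (z i) (zM i); rewrite Fz sub0r normrN eval2E ys0 (HP i).2.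
rewrite hornerM horner_exp !hornerE normrM normrX -/(k i) => lt.
have [le|//] := real_leP (gtr0_real eps0) (normr_real (z i - z0 i)).
have : c * eps ^+ k i <= `|(H i).2.[z i]| * `|z i - z0 i| ^+ k i.
  apply: ler_pM => //; rewrite ?(ltW c0) ?exprn_ge0 ?(ltW eps0) //.
  by rewrite lerXn2r ?nnegrE ?(ltW eps0).
by move=> /(lt_le_trans lt); rewrite ltxx.
Qed.

(** * Prime quotients *)

Section PrimeQuotient.
Variables (A : comNzRingType) (P : A -> Prop).
Hypotheses (P0 : P 0) (PD : forall x y, P x -> P y -> P (x + y)).
Hypotheses (PM : forall x y, P y -> P (x * y)) (P1 : ~ P 1).
Hypothesis Pprime : forall x y, P (x * y) -> P x \/ P y.

Let I : A -> bool := fun x => `[< P x >].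

Let I_idealr : idealr_closed I.
Proof.
split; [exact/asboolP | exact/asboolPn | move=> a u v /asboolP Pu /asboolP Pv].
by apply/asboolP/PD => //; apply: PM.
Qed.

Let J : idealr A := HB.pack I (isIdealr.Build A I I_idealr).

Lemma prime_quotient : exists (D : comNzRingType) (pi : {rmorphism A -> D}),
  (forall x, pi x = 0 <-> P x) /\
  (forall x y : D, x * y = 0 -> x = 0 \/ y = 0).
Proof.
exists {ideal_quot J}.
pose pi : {rmorphism A -> {ideal_quot J}} := (\pi_{ideal_quot J})%qT.
have piE x : pi x = 0 <-> P x.
  rewrite -(rmorph0 pi) /pi; apply: (iff_trans (B := I x)); last by split=> /asboolP.
  have := Quotient.idealrBE J x 0; rewrite subr0 => e.
  by split=> [/eqP|]; [rewrite -e | move=> Ix; apply/eqP; rewrite -e].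
exists pi; split=> // x y.
rewrite -[x]reprK -[y]reprK; move: (repr x) (repr y) => a b.
by move=> /eqP; rewrite -(rmorphM pi) => /eqP /piE /Pprime [] h; [left|right]; apply/piE.
Qed.

End PrimeQuotient.

(** * Hilbert basis theorem *)

(** The ascending chain condition, read on the ideals generated by the first
    terms of a sequence. *)
Definition noetherian (R : comNzRingType) := forall f : nat -> R,
  exists k (c : nat -> R), f k = \sum_(i < k) c i * f i.

Lemma noetherian_surj (R S : comNzRingType) (phi : {rmorphism R -> S}) :
  (forall y, exists x, phi x = y) -> noetherian R -> noetherian S.
Proof.
move=> surj noeR f; have [g gE] := @choice _ _ (fun y x => phi x = y) surj.
have [k [c fk]] := noeR (g \o f); exists k, (phi \o c).
rewrite -[LHS]gE [g _]fk rmorph_sum; apply: eq_bigr => i _.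
by rewrite rmorphM /= gE.
Qed.

Lemma noetherian_field (C : fieldType) : noetherian C.
Proof.
move=> f; have [f0|f0] := eqVneq (f 0%N) 0.
  by exists 0%N, (fun=> 0); rewrite big_ord0.
exists 1%N, (fun=> f 1%N / f 0%N).
by rewrite big_ord1 divfK.
Qed.

Lemma dependent_sequence (T : eqType) (good : T -> Prop) (step : seq T -> T -> Prop) :
  (forall s, (forall x, x \in s -> good x) -> exists2 x, good x & step s x) ->
  exists h : nat -> T, forall k, good (h k) /\ step (mkseq h k) (h k).
Proof.
move=> H; have [|x0 _ _] := H [::]; first by [].
have [nx nxP] : {nx : seq T -> T & forall s,
    (forall x, x \in s -> good x) -> good (nx s) /\ step s (nx s)}.
  apply: (@choice _ _ (fun s x =>
    (forall x, x \in s -> good x) -> good x /\ step s x)) => s.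
  have [gs|ngs] := pselect (forall x, x \in s -> good x); last by exists x0.
  by have [x gx sx] := H s gs; exists x.
pose S := fix S k := if k is k'.+1 then rcons (S k') (nx (S k')) else [::].
pose h k := nx (S k).
have SE k : S k = mkseq h k.
  by elim: k => //= k IH; rewrite -/(h k) IH /mkseq -addn1 iotaD map_cat cats1.
have gS k x : x \in S k -> good x.
  elim: k x => // k IH x; rewrite /= mem_rcons inE => /orP [/eqP ->|/IH//].
  by have [] := nxP _ IH.
by exists h => k; rewrite -SE; apply: nxP; apply: gS.
Qed.

(** Otherwise the ideal I of all the f i is not finitely generated, and one can
    pick h 0, h 1, ... in it, each of least degree outside the ideal spanned by
    the previous ones. A relation between their leading coefficients lets one
    lower the degree of some h k modulo the previous ones. *)
Lemma noetherian_poly (R : comNzRingType) : noetherian R -> noetherian {poly R}.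
Proof.
move=> noeR f; apply: contrapT => nf.
pose I p := exists k (c : nat -> {poly R}), p = \sum_(i < k) c i * f i.
pose span (s : seq {poly R}) p :=
  exists c : nat -> {poly R}, p = \sum_(i < size s) c i * s`_i.
have spanI k s p : (forall x, x \in s -> exists c : nat -> {poly R}, 
    x = \sum_(i < k) c i * f i) -> span s p ->
    exists c : nat -> {poly R}, p = \sum_(i < k) c i * f i.
  move=> sk [c ->]; have [e eE] := @choice _ _
    (fun (j : 'I_(size s)) (e : nat -> {poly R}) => s`_j = \sum_(i < k) e i * f i)
    (fun j => sk _ (mem_nth 0 (ltn_ord j))).
  exists (fun i => \sum_(j < size s) c j * e j i).
  under eq_bigr => j _ do rewrite eE mulr_sumr.
  rewrite exchange_big; apply: eq_bigr => i _; rewrite mulr_suml.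
  by apply: eq_bigr => j _; rewrite mulrA.
have widenI k l x : (k <= l)%N ->
    (exists c : nat -> {poly R}, x = \sum_(i < k) c i * f i) ->
    exists c : nat -> {poly R}, x = \sum_(i < l) c i * f i.
  move=> kl [c ->]; exists (fun i => if (i < k)%N then c i else 0).
  rewrite (big_ord_widen l (fun i => c i * f i)) // big_mkcond.
  by apply: eq_bigr => i _; case: ifP; rewrite ?mul0r.
have ID p q : I p -> I q -> I (p + q).
  move=> [k Ik] [l Il]; exists (maxn k l).
  have [c ->] := widenI _ _ _ (leq_maxl k l) Ik.
  have [e ->] := widenI _ _ _ (leq_maxr k l) Il.
  exists (fun i => c i + e i); rewrite -big_split.
  by apply: eq_bigr => i _; rewrite mulrDl.
have IM p q : I q -> I (p * q).
  move=> [k [c ->]]; exists k, (fun i => p * c i); rewrite mulr_sumr.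
  by apply: eq_bigr => i _; rewrite mulrA.
have I0 : I 0 by exists 0%N, (fun=> 0); rewrite big_ord0.
pose step s x := ~ span s x /\
  forall q, I q -> ~ span s q -> (size x <= size q)%N.
have [s sI|h hP] := @dependent_sequence _ I step.
  (* The elements of s involve only the first k terms of f, so f k is not in
     their span. *)
  have [k sk] : exists k, forall x, x \in s -> exists c : nat -> {poly R},
      x = \sum_(i < k) c i * f i.
    elim: s sI => [|x s IH] sI; first by exists 0%N.
    have [|k sk] := IH; first by move=> y ys; apply: sI; rewrite inE ys orbT.
    have [l Ix] := sI x (mem_head _ _); exists (maxn k l) => y.
    rewrite inE => /orP [/eqP ->|/sk yk]; first exact: (widenI l) (leq_maxr k l) Ix.
    exact: (widenI k) (leq_maxl k l) yk.
  have ex : exists m, `[< exists q, [/\ I q, ~ span s q & size q = m] >].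
    exists (size (f k)); apply/asboolP; exists (f k); split=> //.
      exists k.+1, (fun i => (i == k)%:R); rewrite big_ord_recr /= eqxx mul1r.
      rewrite big1 ?add0r // => i _; rewrite ltn_eqF ?mul0r //.
    by move=> /(spanI _ _ _ sk) fk; apply: nf; exists k.
  case: (ex_minnP ex) => m /asboolP [x [Ix nx <-]] minm.
  exists x => //; split=> // q Iq nq; apply: minm; apply/asboolP.
  by exists q.
have spanh k p : (exists c : nat -> {poly R}, p = \sum_(i < k) c i * h i) -> span (mkseq h k) p.
  move=> [c ->]; exists c; rewrite size_mkseq; apply: eq_bigr => i _.
  by rewrite nth_mkseq.
have hI k : I (h k) := (hP k).1.
have nsp k (c : nat -> {poly R}) : h k <> \sum_(i < k) c i * h i.
  by move=> e; case: (hP k) => _ [ns _]; apply: ns; apply: spanh; exists c.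
have szh i k : (i < k)%N -> (size (h i) <= size (h k))%N.
  move=> ik; case: (hP i) => _ [_ min]; apply: min => // [[c]].
  rewrite size_mkseq => e; apply: (nsp k (fun j => if (j < i)%N then c j else 0)).
  rewrite e (big_ord_widen k (fun j => c j * (mkseq h i)`_j)) ?(ltnW ik) // big_mkcond.
  by apply: eq_bigr => j _; case: ifP => ji; rewrite ?mul0r ?nth_mkseq.
have [k [c ck]] := noeR (fun i => lead_coef (h i)).
have h0 i : (0 < size (h i))%N.
  rewrite lt0n size_poly_eq0; apply/eqP => e.
  by apply: (nsp i (fun=> 0)); rewrite e big1 // => j _; rewrite mul0r.
pose e i := c i *: 'X^(size (h k) - size (h i)).
pose q := h k - \sum_(i < k) e i * h i.
have Iq : I q.
  apply: (ID); first exact: hI.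
  rewrite -mulN1r; apply: (IM).
  by apply: (big_ind I I0 ID) => i _; apply: IM.
have : (size (h k) <= size q)%N.
  case: (hP k) => _ [_ min]; apply: min => // [[b]]; rewrite size_mkseq => qb.
  apply: (nsp k (fun i => b i + e i)); apply/eqP.
  rewrite -(subrK (\sum_(i < k) e i * h i) (h k)) -/q qb -big_split; apply/eqP.
  by apply: eq_bigr => i _; rewrite nth_mkseq // mulrDl.
have eh i : (i < k)%N -> e i * h i = c i *: ('X^(size (h k) - size (h i)) * h i).
  by move=> _; rewrite /e scalerAl.
apply/negP; rewrite -ltnNge -(prednK (h0 k)) ltnS.
apply/leq_sizeP => j; rewrite leq_eqVlt => /orP [/eqP <-|lt]; last first.
  rewrite (prednK (h0 k)) in lt.
  rewrite coefB coef_sum nth_default // big1 ?subr0 // => i _.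
  rewrite eh // coefZ coefXnM ifN; last first.
    by rewrite -leqNgt (leq_trans (leq_subr _ _)).
  rewrite nth_default ?mulr0 // leq_subRL ?subnK ?szh //.
  by rewrite (leq_trans (leq_subr _ _)).
rewrite coefB coef_sum -lead_coefE ck -sumrB big1 // => i _.
rewrite eh // coefZ coefXnM ifN; last first.
  rewrite -leqNgt -subn1 leq_sub2l //.
have sz := szh _ _ (ltn_ord i).
have -> : ((size (h k)).-1 - (size (h k) - size (h i)) = (size (h i)).-1)%N.
  rewrite -!subn1 subnAC subKn //.
by rewrite subrr.
Qed.

Lemma hilbert_basis (C : fieldType) (n : nat) : noetherian {mpoly C[n]}.
Proof.
elim: n => [|n IH].
  apply: noetherian_surj (@noetherian_field C) => y; exists (y@_0); apply/esym.
  by apply: msize1_polyC; rewrite msizeE; apply/bigmax_leqP_seq => m _ _;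
       rewrite mdegE big_ord0.
have := noetherian_poly IH.
apply: (noetherian_surj (phi := horner_eval 'X_ord_max \o map_poly (@mwiden n C))).
by move=> p; exists (muni p); apply: muniK.
Qed.

Lemma finite_equations (C : fieldType) (n : nat) (S : {mpoly C[n]} -> Prop) :
  exists s : seq {mpoly C[n]}, (forall p, p \in s -> S p) /\
    forall x, (forall p, p \in s -> p.@[x] = 0) -> forall p, S p -> p.@[x] = 0.
Proof.
apply: contrapT => H.
pose step (s : seq {mpoly C[n]}) p :=
  exists x, (forall q, q \in s -> q.@[x] = 0) /\ p.@[x] <> 0.
have [s sS|h hP] := @dependent_sequence _ S step.
  apply: contrapT => ns; apply: H; exists s; split=> // x sx p Sp.
  by apply: contrapT => px; apply: ns; exists p => //; exists x.
have [k [c hk]] := @hilbert_basis C n h.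
have [_ [x [xs]]] := hP k; apply.
rewrite hk rmorph_sum big1 // => i _; rewrite /= mevalM (xs (h i)) ?mulr0 //.
by apply/mapP; exists (nat_of_ord i) => //; rewrite mem_iota add0n leq0n /=.
Qed.

(** * Euclidean and Zariski closures *)

(** The points of V outside the zero set of h, for h nonzero at z0, form a filter
    base. For an ultrafilter F refining it, the polynomials vanishing F-almost
    everywhere form a prime ideal, contained in the ideal of z0 and containing
    that of V. It cannot contain S, since finitely many elements of S have no
    common zero on V. *)
Lemma generic_point (C : numFieldType) (n : nat) (V : set ('I_n -> C))
    (S : {mpoly C[n]} -> Prop) (z0 : 'I_n -> C) :
  (forall x, V x -> exists2 g, S g & g.@[x] != 0) ->
  (forall p, (forall x, V x -> p.@[x] = 0) -> p.@[z0] = 0) ->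
  exists (D : comNzRingType) (pi : {rmorphism {mpoly C[n]} -> D}),
  [/\ forall x y : D, x * y = 0 -> x = 0 \/ y = 0,
      forall p, (forall x, V x -> p.@[x] = 0) -> pi p = 0,
      forall p, pi p = 0 -> p.@[z0] = 0 &
      exists2 g, S g & pi g != 0].
Proof.
move=> VS Vz0; have [s [sS sP]] := finite_equations S.
pose B (h : {mpoly C[n]}) : set ('I_n -> C) := [set x | V x /\ h.@[x] != 0].
pose base := filter_from [set h : {mpoly C[n]} | h.@[z0] != 0] B.
have base_filter : ProperFilter base.
  apply: filter_from_proper; last first.
    move=> h hz0; apply: contrapT => Bh; case/eqP: hz0; apply: Vz0 => x Vx.
    by apply: contrapT => /eqP hx; apply: Bh; exists x.
  apply: filter_from_filter.
    by exists 1; rewrite /= meval1 oner_eq0.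
  move=> h k hz kz; exists (h * k); first by rewrite /= mevalM mulf_neq0.
  by move=> x [Vx]; rewrite mevalM mulf_eq0 negb_or => /andP [hx kx].
have [F [FU baseF]] := ultraFilterLemma base_filter.
have FF : ProperFilter F := ultra_proper.
have FB h : h.@[z0] != 0 -> F (B h) by move=> hz; apply: baseF; exists h.
have FV : F V.
  have := FB 1; rewrite meval1 oner_eq0 => /(_ isT).
  by apply: filterS => x [].
pose P (p : {mpoly C[n]}) := F [set x | p.@[x] = 0].
have [|||||D [pi [piE domD]]] := @prime_quotient _ P.
- by apply: filterS FV => x _ /=; rewrite meval0.
- move=> p q Pp Pq; apply: filterS (filterI Pp Pq) => x /= [px qx].
  by rewrite mevalD px qx addr0.
- by move=> p q; apply: filterS => x /= qx; rewrite mevalM qx mulr0.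
- move=> P1; apply: (@filter_not_empty _ F); apply: filterS P1 => x /=.
  by rewrite meval1 => /eqP; rewrite oner_eq0.
- move=> p q Ppq; have [Pp|nPp] := in_ultra_setVsetC [set x | p.@[x] = 0] FU.
    by left.
  right; apply: filterS (filterI Ppq nPp) => x /= [/eqP].
  by rewrite mevalM mulf_eq0 => /orP [] /eqP.
exists D, pi; split=> // [p pV|p /piE Pp|].
- by apply/piE; apply: filterS FV => x /pV.
- apply: contrapT => /eqP /FB Fp; apply: (@filter_not_empty _ F).
  by apply: filterS (filterI Fp Pp) => x /= [[_ /eqP]].
apply: contrapT => nS; apply: (@filter_not_empty _ F).
have : F [set x | forall p, p \in s -> p.@[x] = 0].
  have sP' p : p \in s -> P p.
    by move=> ps; apply: contrapT => nP; apply: nS; exists p;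
       [exact: sS | apply/eqP => /piE].
  elim: s sP' {sS sP} => [|p s IH] sP'; first by apply: filterS FV.
  have Ps : F [set x | forall p, p \in s -> p.@[x] = 0].
    by apply: IH => q qs; apply: sP'; rewrite inE qs orbT.
  apply: filterS (filterI (sP' p (mem_head _ _)) Ps) => x /= [px sx] q.
  by rewrite inE => /orP [/eqP ->|/sx].
move=> Fs; apply: filterS (filterI FV Fs) => x /= [/VS [g Sg /eqP gx] /sP].
by move=> /(_ g Sg).
Qed.

(** The first two hypotheses make V open in its Zariski closure, as the union
    of the loci where some g in S is nonzero. The generic point singles
    out one such g, and its specializations at which g is nonzero lie in V. *)
Theorem euclidean_closure (C : numClosedFieldType) (n : nat)
    (V : set ('I_n -> C)) (S : {mpoly C[n]} -> Prop) (z0 : 'I_n -> C) (eps : C) :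
  (forall x, V x -> exists2 g, S g & g.@[x] != 0) ->
  (forall x g, (forall p, (forall y, V y -> p.@[y] = 0) -> p.@[x] = 0) ->
               S g -> g.@[x] != 0 -> V x) ->
  (forall p, (forall y, V y -> p.@[y] = 0) -> p.@[z0] = 0) -> 0 < eps ->
  exists2 x, V x & forall i, `|x i - z0 i| < eps.
Proof.
move=> VS Vloc Vz0 eps0.
have [D [pi [domD piV piz0 [g Sg pig]]]] := generic_point VS Vz0.
pose iota := pi \o @mpolyC n C; pose xi i := pi 'X_i.
have piE p : mmap iota xi p = pi p.
  by rewrite -[p in RHS]mmap_id rmorph_mmap.
have [|||x [xspec xg xz]] := @specialization_near C D iota n xi z0 g eps domD.
- by move=> p; rewrite piE; apply: piz0.
- by rewrite piE.
- by [].
exists x => //; apply: Vloc Sg xg => p pV; apply: xspec.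
by rewrite piE piV.
Qed.

(** * Closed graphs are generically rational *)

Definition evalp (C : comNzRingType) (n : nat) (P : {poly {mpoly C[n]}})
    (x : 'I_n -> C) : {poly C} := map_poly (meval x) P.

Lemma coef_XsubC_exp (R : comNzRingType) (c : R) d :
  (('X - c%:P) ^+ d.+1)`_d = - (c *+ d.+1).
Proof.
elim: d => [|d IH]; first by rewrite expr1 coefB coefX coefC sub0r.
rewrite exprS mulrBl coefB coefXM /= IH mul_polyC coefZ.
have -> : (('X - c%:P) ^+ d.+1)`_d.+1 = 1.
  have /monicP := monic_exp d.+1 (monicXsubC c).
  by rewrite lead_coefE size_exp_XsubC.
by rewrite mulr1 -opprD -mulrSr.
Qed.

Section GenericRational.
Variables (C : numClosedFieldType) (n : nat).
Variables (X : set ('I_n -> C)) (f : ('I_n -> C) -> C).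

(* On the locus k <> 0 of X, the polynomial P is a relation for f whose degree
   does not drop. *)
Let good (k : {mpoly C[n]}) (P : {poly {mpoly C[n]}}) :=
  (exists2 x, X x & k.@[x] != 0) /\
  (forall x, X x -> k.@[x] != 0 ->
     (lead_coef P).@[x] != 0 /\ root (evalp P x) (f x)).

(* Leading coefficients that vanish identically on X where k is nonzero are
   dropped; the first that does not is made invertible by shrinking the locus. *)
Let truncate k R x1 :
  (forall x, X x -> k.@[x] != 0 -> root (evalp R x) (f x)) ->
  X x1 -> k.@[x1] != 0 -> evalp R x1 != 0 ->
  exists l P, good (k * l) P /\ (size P <= size R)%N.
Proof.
move: {2}(size R) (leqnn (size R)) => m.
elim: m R => [|m IH] R sR Rf Xx1 kx1 Rx1.
  move: Rx1; move: sR; rewrite leqn0 size_poly_eq0 => /eqP ->.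
  by rewrite /evalp rmorph0 eqxx.
have [[x [Xx kx lx]]|nl] := pselect (exists x, [/\ X x, k.@[x] != 0 & (lead_coef R).@[x] != 0]).
  exists (lead_coef R), R; split=> //; split.
    by exists x => //; rewrite mevalM mulf_neq0.
  move=> x' Xx'; rewrite mevalM mulf_eq0 negb_or => /andP [kx' lx'].
  by split=> //; apply: Rf.
pose R' := take_poly (size R).-1 R.
have RE x : X x -> k.@[x] != 0 -> evalp R' x = evalp R x.
  move=> Xx kx; apply/polyP => i; rewrite /evalp !coef_map coef_take_poly.
  case: ltnP => // si; apply/esym.
  have [->|ne] := eqVneq i (size R).-1.
    rewrite raddf0; apply/eqP; apply: contrapT => /negP lx; apply: nl.
    by exists x.
  rewrite nth_default //; move: si; rewrite leq_eqVlt eq_sym (negbTE ne) /=.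
  by case: (size R).
have s0 : (0 < size R)%N.
  rewrite lt0n size_poly_eq0; apply: contraNneq Rx1 => ->.
  by rewrite /evalp rmorph0.
have sR' : (size R' < size R)%N.
  by rewrite -[X in (_ < X)%N](prednK s0) ltnS size_take_poly.
have [|||l [P [lP sP]]] := IH R' _ _ Xx1 kx1.
- by rewrite -ltnS (leq_trans sR').
- by move=> x Xx kx; rewrite RE //; apply: Rf.
- by rewrite RE.
by exists l, P; split=> //; rewrite (leq_trans sP) // ltnW.
Qed.

(** Take, over all nonempty principal open subsets of X where g is nonzero, a
    relation P for f of least degree. Dividing the equations T of the graph by P
    leaves remainders that vanish, by minimality; so every root of P at x lies
    on the graph, and f x is the only root. In characteristic 0 the two top
    coefficients of P then determine f x. *)
Lemma generic_rational (T : {poly {mpoly C[n]}} -> Prop) (g : {mpoly C[n]}) x0 :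
  (forall x t, X x -> (forall Q, T Q -> root (evalp Q x) t) <-> t = f x) ->
  X x0 -> g.@[x0] != 0 ->
  exists h p q : {mpoly C[n]},
    (exists2 x, X x & (g * h).@[x] != 0) /\
    forall x, X x -> (g * h).@[x] != 0 -> q.@[x] != 0 /\ f x = p.@[x] / q.@[x].
Proof.
move=> TP Xx0 gx0.
pose M m := `[< exists l P, good (g * l) P /\ size P = m >].
have exM : exists m, M m.
  (* Over x0 the graph is a single point, so some equation of the graph is not
     identically zero there. *)
  have [Q [TQ Qx0]] : exists Q, T Q /\ ~~ root (evalp Q x0) (f x0 + 1).
    apply: contrapT => H; have /eqP : f x0 + 1 = f x0.
      apply/TP => // Q TQ; apply: contrapT => /negP nr; apply: H.
      by exists Q.
    by rewrite -subr_eq0 addrC addKr oner_eq0.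
  have Qf x : X x -> g.@[x] != 0 -> root (evalp Q x) (f x).
    by move=> Xx _; apply: (TP x (f x) Xx).2.
  have Q0 : evalp Q x0 != 0 by apply: contraNneq Qx0 => ->; rewrite root0.
  have [l [P [lP _]]] := truncate Qf Xx0 gx0 Q0.
  by exists (size P); apply/asboolP; exists l, P.
case: (ex_minnP exM) => m /asboolP [l [P [[[x1 Xx1 kx1] kP] sP]]] minm.
set k := g * l in kx1 kP.
have rootP x t : X x -> k.@[x] != 0 -> root (evalp P x) t -> t = f x.
  move=> Xx kx Pt; apply/(TP x t Xx) => Q TQ.
  have eqQ := Pdiv.ComRing.rdivp_eq P Q.
  set r := Pdiv.CommonRing.rmodp Q P in eqQ.
  have eqQx y := congr1 (map_poly (meval y)) eqQ.
  have r0 : evalp r x = 0.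
    apply/eqP; apply: contrapT => /negP rx0.
    have rf y : X y -> k.@[y] != 0 -> root (evalp r y) (f y).
      move=> Xy ky; have := eqQx y; rewrite map_polyZ rmorphD rmorphM /=.
      move=> /(congr1 (horner^~ (f y))); rewrite hornerZ hornerD hornerM.
      have /eqP -> := (kP y Xy ky).2.
      have /eqP -> : root (evalp Q y) (f y) by apply: (TP y (f y) Xy).2.
      by rewrite !mulr0 add0r /root => <-.
    have [l' [P' [lP' sP']]] := truncate rf Xx kx rx0.
    have : M (size P').
      by apply/asboolP; exists (l * l'), P'; split=> //; rewrite mulrA.
    move=> /minm; rewrite leqNgt -sP (leq_ltn_trans sP') //.
    rewrite Pdiv.CommonRing.ltn_rmodp; apply: contraTneq (kP x1 Xx1 kx1).1 => ->.
    by rewrite lead_coef0 meval0 eqxx.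
  have := eqQx x; rewrite map_polyZ rmorphD rmorphM /=.
  rewrite -/(evalp r x) r0 addr0 => /(congr1 (horner^~ t)).
  rewrite hornerZ hornerM; move: Pt; rewrite /root => /eqP ->.
  rewrite mulr0 => /eqP; rewrite rmorphXn mulf_eq0 => /orP [|//].
  by rewrite expf_eq0 (negbTE (kP x Xx kx).1) andbF.
pose d := m.-2; exists l, P`_d, (- (d.+1)%:R%:MP * lead_coef P).
split; first by exists x1.
move=> x Xx kx; have [lx fx] := kP x Xx kx.
have sPx : size (evalp P x) = m by rewrite size_map_poly_id0.
have lPx : lead_coef (evalp P x) = (lead_coef P).@[x] by rewrite lead_coef_map_eq.
have md : m = d.+2.
  have : (1 < m)%N by rewrite -sPx (root_size_gt1 _ fx) // -lead_coef_eq0 lPx.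
  by rewrite /d; case: (m) => [|[]].
have [r Pr] := closed_field_poly_normal (evalp P x).
have sr : size r = d.+1.
  by have := sPx; rewrite Pr lPx size_scale // size_prod_XsubC md => -[].
have rE : r = nseq d.+1 (f x).
  rewrite -sr; apply/all_pred1P/allP => t tr /=; apply/eqP/rootP => //.
  by rewrite Pr rootZ ?lPx // root_prod_XsubC.
have : (evalp P x)`_d = (lead_coef P).@[x] * - (f x *+ d.+1).
  by rewrite Pr lPx rE big_nseq iter_mulr_1 coefZ coef_XsubC_exp.
rewrite coef_map /= => Pd.
have nz : (- (d.+1)%:R%:MP * lead_coef P).@[x] != 0.
  by rewrite mevalM mevalN mevalC mulf_neq0 ?oppr_eq0 ?pnatr_eq0.
split=> //; apply: (canRL (mulfK nz)).
rewrite Pd mevalM mevalN mevalC -[f x *+ _]mulr_natr mulNr !mulrN.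
by rewrite mulrA [in RHS]mulrC.
Qed.

End GenericRational.

(** * Rational continuous functions have closed graphs *)

(** Polynomials are Lipschitz near z, a property stable under sums and
    products. *)
Lemma meval_cont (C : numFieldType) (n : nat) (p : {mpoly C[n]})
    (z : 'I_n -> C) (eps : C) : 0 < eps ->
  exists2 d, 0 < d & forall y, (forall i, `|y i - z i| < d) ->
    `|p.@[y] - p.@[z]| < eps.
Proof.
pose lip (F : ('I_n -> C) -> C) := exists2 K, 0 <= K &
  forall (y : 'I_n -> C) d, 0 < d -> d <= 1 -> (forall i, `|y i - z i| < d) ->
    `|F y - F z| <= K * d.
have lipC c : lip (fun=> c).
  by exists 0 => // y d d0 _ _; rewrite subrr normr0 mul0r.
have lipX i : lip (fun y => y i).
  by exists 1 => // y d d0 _ yd; rewrite mul1r ltW.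
have lipD F G : lip F -> lip G -> lip (fun y => F y + G y).
  move=> [K K0 FK] [L L0 GL]; exists (K + L) => [|y d d0 d1 yd]; first exact: addr_ge0.
  rewrite opprD addrACA mulrDl; apply: (le_trans (ler_normD _ _)).
  by apply: lerD; [exact: FK|exact: GL].
have lipM F G : lip F -> lip G -> lip (fun y => F y * G y).
  move=> [K K0 FK] [L L0 GL]; exists (K * (L + `|G z|) + `|F z| * L) => [|y d d0 d1 yd].
    by rewrite addr_ge0 ?mulr_ge0 ?addr_ge0.
  have -> : F y * G y - F z * G z = (F y - F z) * G y + F z * (G y - G z).
    by rewrite mulrBl mulrBr addrA subrK.
  have Gy : `|G y| <= L + `|G z|.
    rewrite -[G y](subrK (G z)); apply: (le_trans (ler_normD _ _)).
    rewrite lerD2r; apply: (le_trans (GL y d d0 d1 yd)).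
    by rewrite ler_piMr.
  rewrite [X in _ <= X]mulrDl; apply: (le_trans (ler_normD _ _)); apply: lerD; rewrite normrM.
    rewrite -mulrA [_ * d]mulrC mulrA; apply: ler_pM => //; exact: FK.
  by rewrite -mulrA ler_wpM2l // GL.
have [K K0 pK] : lip (fun y => p.@[y]).
  rewrite /meval /mmap; elim: (msupp p) => [|m s IH].
    by under eq_fun do rewrite big_nil; apply: lipC.
  under eq_fun do rewrite big_cons.
  apply: (lipD) => //; apply: (lipM); first exact: lipC.
  rewrite /mmap1; elim: (index_enum _) => [|i r IHr].
    by under eq_fun do rewrite big_nil; apply: lipC.
  under eq_fun do rewrite big_cons.
  apply: (lipM) => //; elim: (m i) => [|k IHk].
    by under eq_fun do rewrite expr0; apply: lipC.
  by under eq_fun do rewrite exprS; apply: (lipM).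
move=> eps0; exists (eps / (K + eps + 1)).
  by rewrite divr_gt0 // ltr_wpDl ?ltr01 // addr_ge0 // ltW.
have K1 : 0 < K + eps + 1 by rewrite ltr_wpDl ?ltr01 // addr_ge0 // ltW.
move=> y /(pK y _ _ _) h; apply: (le_lt_trans (h _ _)).
- by rewrite divr_gt0.
- by rewrite ler_pdivrMr // mul1r -addrA addrCA lerDl addr_ge0.
rewrite mulrCA -[X in _ < X]mulr1 ltr_pM2l // ltr_pdivrMr // mul1r.
by rewrite -addrA ltrDl ltr_wpDl // ltW.
Qed.

Lemma ex_pos_le2 (C : numDomainType) (a b : C) : 0 < a -> 0 < b ->
  exists2 c, 0 < c & c <= a /\ c <= b.
Proof.
move=> a0 b0; have [ab|ba] := real_leP (gtr0_real a0) (gtr0_real b0).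
  by exists a.
by exists b => //; split=> //; exact: ltW.
Qed.

Section Graph.
Variables (C : numClosedFieldType) (n : nat).
Variables (X U : set ('I_n -> C)) (f : ('I_n -> C) -> C).
Variables (SX S : {mpoly C[n]} -> Prop).

Definition join (x : 'I_n -> C) (t : C) (i : 'I_(n + 1)) : C :=
  match split i with inl j => x j | inr _ => t end.

Definition add_var (P : {poly {mpoly C[n]}}) : {mpoly C[n + 1]} :=
  (map_poly (mmap (@mpolyC (n + 1) C) (fun i => 'X_(lshift 1 i))) P).['X_(rshift n ord0)].

Definition last_var (p : {mpoly C[n + 1]}) : {poly {mpoly C[n]}} :=
  mmap (@polyC {mpoly C[n]} \o @mpolyC n C)
    (fun i => match split i with inl j => ('X_j)%:P | inr _ => 'X end) p.

Lemma meval_add_var P z :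
  (add_var P).@[z] =
  (evalp P (fun i => z (lshift 1 i))).[z (rshift n ord0)].
Proof.
rewrite /add_var -horner_map /= mevalXU -map_poly_comp; congr (horner _ _).
apply: eq_map_poly => c /=; rewrite rmorph_mmap; apply: mmap_ext => i /=.
  by rewrite mevalC.
by rewrite mevalXU.
Qed.

Lemma evalp_last_var p x t : (evalp (last_var p) x).[t] = p.@[join x t].
Proof.
rewrite /evalp /last_var rmorph_mmap -horner_evalE rmorph_mmap; apply: mmap_ext => i /=.
  by rewrite map_polyC /= mevalC horner_evalE hornerC.
rewrite /join horner_evalE; case: split => j; last by rewrite map_polyX hornerX.
by rewrite map_polyC hornerC /= mevalXU.
Qed.

Lemma join_lshift x t : (fun i => join x t (lshift 1 i)) = x.
Proof. by apply/funext => i; rewrite /join (unsplitK (inl i)). Qed.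

Lemma join_rshift x t : join x t (rshift n ord0) = t.
Proof. by rewrite /join (unsplitK (inr ord0)). Qed.

Lemma joinK z : join (fun i => z (lshift 1 i)) (z (rshift n ord0)) = z.
Proof.
apply/funext => i; rewrite /join; case: split_ordP => j -> //.
by rewrite (ord1 j).
Qed.

Hypothesis X_closed : forall x, X x <-> forall p, SX p -> p.@[x] = 0.
Hypothesis UX : U `<=` X.
Hypothesis U_open : forall x, X x -> (U x <-> exists2 g, S g & g.@[x] != 0).
Hypothesis U_dense : forall p : {mpoly C[n]},
  (forall x, U x -> p.@[x] = 0) -> forall x, X x -> p.@[x] = 0.
Hypothesis f_regular : forall x, U x -> exists h p q : {mpoly C[n]},
  h.@[x] != 0 /\
  forall y, X y -> h.@[y] != 0 -> q.@[y] != 0 /\ f y = p.@[y] / q.@[y].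
Hypothesis f_cont : forall x0, X x0 -> forall eps, 0 < eps ->
  exists2 d, 0 < d & forall x, X x -> (forall i, `|x i - x0 i| < d) ->
    `|f x - f x0| < eps.

(** U is Euclidean dense in X, being Zariski dense and open; the rest is
    continuity. *)
Lemma vanish_on_graph (p : {mpoly C[n + 1]}) :
  (forall x, U x -> p.@[join x (f x)] = 0) ->
  forall x, X x -> p.@[join x (f x)] = 0.
Proof.
move=> pU x1 Xx1; apply/eqP; apply: contrapT => /negP p0.
have pn : 0 < `|p.@[join x1 (f x1)]| by rewrite normr_gt0.
have [d d0 dP] := meval_cont p (join x1 (f x1)) pn.
have [e e0 eP] := f_cont Xx1 d0.
have [c c0 [cd ce]] := ex_pos_le2 d0 e0.
have [|||x Ux xx1] := @euclidean_closure C n U S x1 c _ _ _ c0.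
- by move=> x Ux; apply/U_open => //; apply: UX.
- move=> x g xcl Sg gx; have Xx : X x.
    by apply/X_closed => p' SXp'; apply: xcl => y /UX /X_closed; apply.
  by apply/U_open => //; exists g.
- by move=> p' p'U; apply: U_dense.
have := dP (join x (f x)); rewrite (pU x Ux) sub0r normrN ltxx => H.
suff : false by []. apply: H => i; rewrite /join; case: split => j.
  exact: lt_le_trans (xx1 j) cd.
by apply: eP => [|k]; [exact: UX | exact: lt_le_trans (xx1 k) ce].
Qed.

(** The graph over U is locally closed: near a point where f = p / q it is given
    in its Zariski closure by the equation q t = p. So (x0, t0), which is in the
    Zariski closure of that graph, is a Euclidean limit of points (x, f x), and
    the continuity of f at x0 gives t0 = f x0. *)
Theorem graph_closure x0 t0 :
  X x0 ->
  (forall p, (forall x, X x -> p.@[join x (f x)] = 0) -> p.@[join x0 t0] = 0) ->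
  t0 = f x0.
Proof.
move=> Xx0 cl0; apply/eqP; apply: contrapT => /negP ne.
have e0 : 0 < `|t0 - f x0| / 2%:R by rewrite divr_gt0 ?ltr0n // normr_gt0 subr_eq0.
have [d d0 dP] := f_cont Xx0 e0.
have [c c0 [cd ce]] := ex_pos_le2 d0 e0.
pose V : set ('I_(n + 1) -> C) := [set z | exists2 x, U x & z = join x (f x)].
pose SV (p : {mpoly C[n + 1]}) := exists2 g, S g & p = add_var g%:P.
have addC (g : {mpoly C[n]}) z : (add_var g%:P).@[z] = g.@[fun i => z (lshift 1 i)].
  by rewrite meval_add_var /evalp map_polyC hornerC.
have [|||z [x Ux ->] zz0] := @euclidean_closure C (n + 1) V SV (join x0 t0) c _ _ _ c0.
- move=> z [x Ux ->]; have [g Sg gx] := (U_open (UX Ux)).1 Ux.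
  by exists (add_var g%:P); [exists g | rewrite addC join_lshift].
- move=> z _ zcl [g Sg ->]; rewrite addC; set x := (fun i => _) => gx.
  have Xx : X x.
    apply/X_closed => p SXp; rewrite /x -addC; apply: zcl => _ [y Uy ->].
    by rewrite addC join_lshift; apply: (X_closed y).1 SXp; apply: UX.
  have Ux : U x by apply/U_open => //; exists g.
  have [h [p [q [hx hP]]]] := f_regular Ux.
  have [qx fx] := hP x Xx hx.
  exists x => //; rewrite -[LHS]joinK; congr join.
  have := zcl (add_var (h%:P * (q *: 'X - p%:P))) _.
  have ev y : (evalp (h%:P * (q *: 'X - p%:P)) y) = (h.@[y])%:P * (q.@[y] *: 'X - (p.@[y])%:P).
    by rewrite /evalp rmorphM rmorphB /= map_polyZ !map_polyC map_polyX.
  rewrite meval_add_var ev -/x !hornerE => H.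
  have /eqP : h.@[x] * (q.@[x] * z (rshift n ord0) - p.@[x]) = 0.
    apply: H => _ [y Uy ->]; rewrite meval_add_var join_lshift join_rshift ev !hornerE.
    have [hy|hy] := eqVneq h.@[y] 0; first by rewrite hy mul0r.
    have [qy ->] := hP y (UX Uy) hy.
    by rewrite mulrCA divff // mulr1 subrr mulr0.
  rewrite mulf_eq0 (negbTE hx) /= subr_eq0 => /eqP e.
  by rewrite fx -e mulrC mulKf.
- move=> p pV; apply: cl0; apply: vanish_on_graph => x Ux.
  by apply: pV; exists x.
have xx0 i : `|x i - x0 i| < d.
  have := zz0 (lshift 1 i); have /(congr1 (@^~ i)) /= -> := join_lshift x (f x).
  have /(congr1 (@^~ i)) /= -> := join_lshift x0 t0.
  by move/lt_le_trans; apply.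
have := zz0 (rshift n ord0); rewrite !join_rshift => /lt_le_trans /(_ ce) ft.
have fx := dP x (UX Ux) xx0.
have : `|t0 - f x0| < `|t0 - f x0|.
  rewrite [X in _ < X]splitr -{1}(subrK (f x) t0) -addrA.
  apply: (le_lt_trans (ler_normD _ _)); apply: ltrD => //.
  by rewrite distrC.
by rewrite ltxx.
Qed.

End Graph.

End AffineGeometry.

From mathcomp Require Import all_classical all_reals all_analysis.

Import Order.TTheory GRing.Theory Num.Theory.
Import numFieldNormedType.Exports.

Local Open Scope classical_set_scope.
Local Open Scope ring_scope.

Import AffineGeometry.

(** * Row vectors and the Euclidean topology *)

Section RowVectors.
Set Implicit Arguments.
Unset Strict Implicit.

Lemma within_continuous_eps (K : numFieldType) (n : nat) (X : set 'rV[K]_n)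
    (f : 'rV[K]_n -> K) :
  {within X, continuous f} ->
  forall x0, X x0 -> forall eps, 0 < eps ->
  exists2 d, 0 < d & forall x, X x -> (forall i, `|x ord0 i - x0 ord0 i| < d) ->
    `|f x - f x0| < eps.
Proof.
move=> fc x0 Xx0 eps eps0.
have := fc x0; move/cvgrPdist_lt => /(_ eps eps0).
rewrite /prop_near1 /nbhs /= -nbhs_subspace_in // /within /=.
move=> /nbhs_ballP [d /= d0 dP]; exists d => // x Xx xx0.
rewrite distrC; apply: dP Xx; split=> [//|i j].
by rewrite (ord1 i) -ball_normE /= distrC; apply: xx0.
Qed.

Definition vec (R : realType) (n : nat) (x : 'I_n -> Cplx R) : 'rV[Cplx R]_n :=
  \row_i x i.

Lemma vecK (R : realType) (n : nat) (x : 'rV[Cplx R]_n) :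
  vec (fun i => x ord0 i) = x.
Proof. by apply/rowP => i; rewrite mxE. Qed.

Lemma peval_vec (R : realType) (n : nat) (p : mpoly.mpoly n (Cplx R))
    (x : 'I_n -> Cplx R) : peval p (vec x) = mpoly.meval x p.
Proof. by apply: mpoly.meval_eq => i; rewrite mxE. Qed.

Lemma peval_join (R : realType) (n : nat) (p : mpoly.mpoly (n + 1) (Cplx R))
    (x : 'I_n -> Cplx R) (t : Cplx R) :
  peval p (row_mx (vec x) (const_mx t)) = mpoly.meval (join x t) p.
Proof.
apply: mpoly.meval_eq => i; rewrite /join mxE.
by case: (fintype.split i) => j; rewrite !mxE.
Qed.

End RowVectors.

Theorem corollary4p19 (R : realType) (n : nat) (X : set 'rV[Cplx R]_n)
    (hX : zariski_closed X)
    (f : 'rV[Cplx R]_n -> Cplx R)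
    (hf : {within X, continuous f}) :
  zariski_closed_in (prod_line X) (graph_on X f) <-> K0 X f.
Proof.
case: hX => SX XE.
pose Xf : set ('I_n -> Cplx R) := [set x | X (vec x)].
pose ff (x : 'I_n -> Cplx R) := f (vec x).
have XfE x : Xf x <-> forall p, SX p -> mpoly.meval x p = 0.
  rewrite /Xf /= XE /=; split=> h p Sp.
    by rewrite -peval_vec; apply: h.
  by rewrite peval_vec; apply: h.
have vecP (x : 'rV[Cplx R]_n) : exists y, x = vec y by exists (fun i => x ord0 i); rewrite vecK.
split=> [[Z [SZ ZE] gE]|[[U [[Z [S ZE] UE] [UX Udense] Ureg]] _]].
- split=> //.
  have inX x t : X x -> (Z (row_mx x (const_mx t)) <-> t = f x).
    move=> Xx; have : graph_on X f (row_mx x (const_mx t)) <-> Z (row_mx x (const_mx t)).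
      rewrite gE; split=> [[]//|Zxt]; split=> //.
      by rewrite /prod_line /= row_mxKl.
    move=> <-; split=> [[y Xy /eq_row_mx [-> /matrixP /(_ ord0 ord0)]]|->].
      by rewrite !mxE => ->.
    by exists x.
  pose T Q := exists2 p, SZ p & Q = last_var p.
  have TP x t : Xf x -> (forall Q, T Q -> root (evalp Q x) t) <-> t = ff x.
    move=> Xx; rewrite -(inX _ _ Xx) ZE /=; split=> h.
      move=> p Sp; rewrite peval_join -evalp_last_var; apply/eqP.
      by apply: h; exists p.
    move=> _ [p Sp ->]; rewrite /root evalp_last_var -peval_join.
    by apply/eqP/h.
  (* The complement of Z0 is the union of the principal open subsets of X on
     which f is a quotient of two polynomials. *)
  pose S h := exists p q, forall x, Xf x -> mpoly.meval x h != 0 ->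
    mpoly.meval x q != 0 /\ ff x = mpoly.meval x p / mpoly.meval x q.
  pose Z0 := [set x | forall h, S h -> peval h x = 0].
  have Z0c : zariski_closed Z0 by exists S.
  exists (X `\` Z0); split; first by exists Z0.
  + split=> [x []//|V [W [SW WE] ->] [x0 [Xx0 Wx0]]].
    have [g Sg gx0] : exists2 g, SW g & peval g x0 != 0.
      apply: contrapT => H; apply: Wx0; rewrite WE => g Sg; apply/eqP.
      by apply: contrapT => /negP gx; apply: H; exists g.
    have [y0 y0E] := vecP x0; subst x0; rewrite peval_vec in gx0.
    have [h [p [q [[x Xx ghx] ghP]]]] := generic_rational TP Xx0 gx0.
    exists (vec x); split; split=> //.
      rewrite WE => /(_ _ Sg); rewrite peval_vec => gx.
      by move: ghx; rewrite mpoly.mevalM gx mul0r eqxx.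
    move=> Zx; move: ghx; rewrite -peval_vec Zx ?eqxx //.
    by exists p, q.
  move=> x [Xx Zx].
  have [h [p [q hP]] hx] : exists2 h, S h & peval h x != 0.
    apply: contrapT => H; apply: Zx => h Sh; apply/eqP.
    by apply: contrapT => /negP hx; apply: H; exists h.
  exists (X `\` [set y | peval h y = 0]), p, q; split.
  + exists [set y | peval h y = 0] => //; exists [set h].
    by apply/seteqP; split=> y /= hy; [move=> _ -> | apply: hy].
  + by split=> //; apply/eqP.
  + move=> y [Xy /= hy]; split=> // Zy; apply: hy; apply: Zy.
    by exists p, q.
  move=> y [Xy /= /eqP hy]; have [y' yE] := vecP y; subst y.
  by rewrite !peval_vec in hy *; apply: hP.
(* The Zariski closure of the graph. *)
exists [set z | forall p, (forall x, X x -> peval p (row_mx x (const_mx (f x))) = 0) ->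
                 peval p z = 0].
  by eexists.
apply/seteqP; split=> [_ [x Xx <-]|z [Xz zcl]].
  by split; [rewrite /prod_line /= row_mxKl | move=> p; apply].
pose Uf : set ('I_n -> Cplx R) := [set x | U (vec x)].
have zE : z = row_mx (lsubmx z) (const_mx (rsubmx z ord0 ord0)).
  rewrite -[LHS]hsubmxK; congr row_mx; apply/matrixP => i j.
  by rewrite !ord1 [RHS]mxE.
exists (lsubmx z) => //; rewrite [RHS]zE; congr (row_mx _ (const_mx _)); apply/esym.
have [x0 x0E] := vecP (lsubmx z); rewrite x0E.
move: Xz; rewrite /prod_line /= x0E => Xx0.
apply: (@graph_closure _ n Xf Uf ff SX S) => //.
- by move=> x; apply: UX.
- move=> x Xx; rewrite /Uf /= UE; split=> [[_ Zx]|[g Sg gx]].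
    apply: contrapT => H; apply: Zx; rewrite ZE => g Sg; apply/eqP.
    apply: contrapT => /negP gx; apply: H; exists g => //.
    by rewrite -peval_vec.
  split=> //; rewrite ZE => /(_ _ Sg); rewrite peval_vec => gx0.
  by rewrite gx0 eqxx in gx.
- move=> p pU x Xx; apply/eqP; apply: contrapT => /negP px.
  pose V := X `\` [set y | peval p y = 0].
  have Vo : zariski_open_in X V.
    exists [set y | peval p y = 0] => //; exists [set p].
    by apply/seteqP; split=> y /= hy; [move=> _ -> | apply: hy].
  have [|y [[Xy py] Uy]] := Udense V Vo.
    by exists (vec x); split=> //=; rewrite peval_vec; apply/eqP.
  by apply: py; have [y' yE] := vecP y; subst y; rewrite /= peval_vec; apply: pU.
- move=> x Ux; have [V [p [q [[W [SW WE] ->] [Xx Wx] VU pq]]]] := Ureg _ Ux.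
  have [h Sh hx] : exists2 h, SW h & peval h (vec x) != 0.
    apply: contrapT => H; apply: Wx; rewrite WE => h Sh; apply/eqP.
    by apply: contrapT => /negP hx; apply: H; exists h.
  exists h, p, q; split; first by rewrite -peval_vec.
  move=> y Xy hy; rewrite -!peval_vec; apply: pq; split=> //.
  by rewrite WE => /(_ _ Sh) /eqP; rewrite peval_vec (negbTE hy).
- move=> y0 Xy0 eps eps0; have [d d0 dP] := within_continuous_eps hf Xy0 eps0.
  exists d => // x Xx xd; apply: dP => // i; rewrite !mxE; exact: xd.
move=> p pX; rewrite -peval_join -x0E -zE; apply: zcl => x Xx.
have [y yE] := vecP x; subst x; rewrite peval_join; exact: pX.
Qed.
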